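(* Let $\theta > 1$ be an irrational number of finite type, let $\psi \ge 0$, and let $\varepsilon > 0$. For $x \ge 1$ let \[\mathcal B(x) = \{\lfloor \theta n + \psi \rfloor : n \in \mathbb N,\ 1 \le n \le x\}.\] Then \[|\{m \in \mathcal B(x) : P(m) \le y\}| = \frac{1}{\theta}\,\Psi(\theta x, y)\,(1 + o(1))\] as $x \to \infty$, uniformly for $(\log x)^{3+\varepsilon} \le y \le x$; that is, \[\sup_{(\log x)^{3+\varepsilon} \le y \le x}\left| \frac{\theta\,|\{m \in \mathcal B(x) : P(m) \le y\}|}{\Psi(\theta x,y)} - 1\right| \to 0 \quad (x \to \infty).\]
   Context: $\lfloor t \rfloor$ denotes the integer part of $t$ and $|\cdot|$ denotes cardinality. For $n \in \mathbb N$, $P(n)$ is the largest prime factor of $n$ (with $P(1)=1$). For $X \ge 1$ and $y \ge 2$, $\Psi(X,y)$ is the number of positive integers $n \le X$ with $P(n) \le y$. An irrational number $\theta$ is of finite type if there exist $c > 0$ and $\kappa > 0$ such that $\|m\theta\| \ge c\, m^{-\kappa}$ for all $m \in \mathbb N$, where $\|t\|$ is the distance from $t$ to the nearest integer. *)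

(* Defs.v *)
From HB Require Import structures.
From mathcomp Require Import all_boot all_order all_algebra finmap.
From mathcomp Require Import all_classical all_reals all_analysis.

Set Implicit Arguments.
Unset Strict Implicit.
Unset Printing Implicit Defensive.

Import Order.TTheory GRing.Theory Num.Theory.
Import numFieldNormedType.Exports.

Local Open Scope classical_set_scope.
Local Open Scope ring_scope.

(* Distance from [t] to the nearest integer; the infimum is over a nonempty
   set bounded below by 0. *)
Definition dist_int (R : realType) (t : R) : R :=
  inf [set `|t - k%:~R| | k in [set: int]].

Definition finite_type (R : realType) (theta : R) : Prop :=
  exists c kappa : R, [/\ 0 < c, 0 < kappa &
    forall m : nat, (0 < m)%N ->
      c * m%:R `^ (- kappa) <= dist_int (m%:R * theta)].

(* [max_pdiv n] is the largest prime factor of [n], with [max_pdiv 1 = 1]. *)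
Definition smooth (R : realType) (y : R) : set nat :=
  [set m | (max_pdiv m)%:R <= y].

(* For [1 <= theta] and [0 <= psi] the floor is nonnegative, so no term of the
   sequence is lost by taking [m] in [nat]. *)
Definition beatty (R : realType) (theta psi x : R) : set nat :=
  [set m | exists n : nat, [/\ (0 < n)%N, n%:R <= x &
    Posz m = Num.floor (theta * n%:R + psi)]].

Definition initial (R : realType) (x : R) : set nat :=
  [set n | (0 < n)%N /\ n%:R <= x].

Lemma finite_initial (R : realType) (x : R) : finite_set (initial x).
Proof.
apply: (@sub_finite_set _ _ `I_(Num.truncn x).+1); last exact: finite_II.
by move=> n [_ nx] /=; rewrite ltnS truncn_ge_nat// (le_trans _ nx).
Qed.

Lemma finite_beatty (R : realType) (theta psi x : R) :
  finite_set (beatty theta psi x).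
Proof.
apply: (sub_finite_set _
  (finite_image (fun n : nat => `|Num.floor (theta * n%:R + psi)|%N)
     (finite_initial x))).
by move=> m [n [n0 nx e]]; exists n => //; rewrite -e.
Qed.

(* [fset_set] is the finite set underlying a classical set that is finite (and
   is empty otherwise); the two lemmas above show that the sets counted below
   are finite. *)
Definition Psi (R : realType) (X y : R) : nat :=
  #|` fset_set (initial X `&` smooth y) |%fset.

Definition smooth_beatty_count (R : realType) (theta psi x y : R) : nat :=
  #|` fset_set (beatty theta psi x `&` smooth y) |%fset.

(* Main.v *)
(* An integer m is a term of the Beatty sequence exactly when the fractional part
   of (psi - m) / theta is below 1 / theta, up to boundedly many m. By Fejer kernels
   it therefore suffices to show that, for each fixed h > 0, the sum of e(m beta)
   over the y-smooth m <= X, with beta = h / theta, is o(Psi(X, y)).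

   If y >= X^(1/k), then Psi(X, y) >> X and Katai's bilinear argument applies; it
   only uses that beta is irrational. Otherwise take a Dirichlet approximation
   |q beta - al| <= 1 / sqrt X and N of order max(q, X |q beta - al|), which is at
   least X^eta by the finite type condition. Factor m = c a, where c in [N, N y) is
   the product of the least prime factors of m. After Cauchy-Schwarz over all
   integers c, what remains is to count smooth a <= X / N with a beta in a given arc
   of length 1 / (N y); there are at most Psi(X y^4 / N^2, y) of them, up to constants.
   With Psi(X / D, y) << y D^(-sigma) Psi(X, y) for some sigma > 2/3, available since
   y >= (log X)^(3 + eps), the square of the sum is at most
   y^11 N^(2 - 3 sigma) Psi(X, y)^2 up to constants, and N beats any fixed power of y. *)
Require Import Defs.
From HB Require Import structures.
From mathcomp Require Import all_boot all_order all_algebra finmap.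
From mathcomp Require Import all_classical all_reals all_analysis.
From mathcomp Require Import zify ring lra.

Set Implicit Arguments.
Unset Strict Implicit.
Unset Printing Implicit Defensive.

Import Order.TTheory GRing.Theory Num.Theory.
Import numFieldNormedType.Exports.

Local Open Scope classical_set_scope.
Local Open Scope ring_scope.

(** * Smooth numbers and primes *)

(** The exponent 3 is decided by the balance of the last step. Cauchy-Schwarz over all integers [c]
    ignores that smooth [c] are sparse and loses a factor [N ^ 2]; the counts of smooth [a <= X / N]
    and of those in one arc return [N ^ (-sigma)] and [N ^ (-2 sigma)]. Hence [sigma > 2/3]. When
    [ln X <= y ^ mu], Chebyshev's bound alone yields the ratio estimate for every [sigma < 1 - mu],
    so the argument can afford [mu < 1/3]; the estimates are stated with [ln X <= y ^ mu] rather
    than with a power of a logarithm. The two ranges are forced by the losses of powers of [y],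
    which are harmless only if [y] is a small power of [X]. For larger [y] the smooth numbers have
    positive density, and a bound [o(X)] without any rate suffices. Exponential sums appear as real
    sums of [cos (2 pi m beta + phi)] bounded for every phase [phi], which amounts to bounding the
    complex sum. Cauchy-Schwarz appears as [|u| <= (u ^ 2 / xi + xi) / 2] with a parameter [xi]
    fixed in advance. *)

Definition lep (y : nat) : nat_pred := [pred p | (p <= y)%N].

Definition smooths (X y : nat) : seq nat :=
  [seq m <- iota 1 X | (lep y).-nat m].

Lemma mem_smooths X y m :
  (m \in smooths X y) = [&& (0 < m)%N, (m <= X)%N & (lep y).-nat m].
Proof.
by rewrite mem_filter mem_iota add1n ltnS andbC -andbA.
Qed.

Lemma smooths_uniq X y : uniq (smooths X y).
Proof. by rewrite filter_uniq ?iota_uniq. Qed.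

Lemma smooths_ge1 X y m : m \in smooths X y -> (0 < m)%N.
Proof. by rewrite mem_smooths => /andP[]. Qed.

Lemma leq_smooths X X' y : (X <= X')%N ->
  (size (smooths X y) <= size (smooths X' y))%N.
Proof.
move=> le_X; apply: uniq_leq_size; first exact: smooths_uniq.
move=> m; rewrite !mem_smooths => /and3P[-> lem ->].
by rewrite (leq_trans lem le_X).
Qed.

Lemma size_smooths_gt0 X y : (0 < X)%N -> (0 < size (smooths X y))%N.
Proof.
move=> X0; have : 1%N \in smooths X y by rewrite mem_smooths X0 andbT.
by case: (smooths X y).
Qed.

Lemma smooths_all X y : (X <= y)%N -> smooths X y = iota 1 X.
Proof.
move=> Xy; apply/all_filterP/allP => m; rewrite mem_iota add1n ltnS => /andP[m0 mX].
apply/pnatP => // p pp pm.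
by rewrite inE (leq_trans (dvdn_leq m0 pm))// (leq_trans mX).
Qed.

Lemma smooths_dvd_perm X y d : (lep y).-nat d ->
  perm_eq [seq m <- smooths X y | (d %| m)%N]
          [seq (d * a)%N | a <- smooths (X %/ d) y].
Proof.
move=> sd; have d0 := part_gt0 (lep y) d.
have {}d0 : (0 < d)%N by case/andP: sd.
apply: uniq_perm.
- by rewrite filter_uniq ?smooths_uniq.
- rewrite map_inj_in_uniq ?smooths_uniq// => a b _ _ /eqP.
  by rewrite eqn_pmul2l// => /eqP.
move=> m; rewrite mem_filter mem_smooths; apply/idP/mapP => [|[a]].
  case/and4P => /dvdnP[a ->] m0 mX; rewrite pnatM => /andP[sa _].
  exists a; last by rewrite mulnC.
  rewrite mem_smooths sa andbT leq_divRL// mX andbT.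
  by move: m0; rewrite muln_gt0 => /andP[].
rewrite mem_smooths => /and3P[a0 aX sa] ->.
by rewrite dvdn_mulr// pnatM sd sa muln_gt0 d0 a0 mulnC -leq_divRL// aX.
Qed.

Lemma sum_smooths_dvd (V : nmodType) (f : nat -> V) X y d : (lep y).-nat d ->
  \sum_(m <- smooths X y | (d %| m)%N) f m =
  \sum_(a <- smooths (X %/ d) y) f (d * a)%N.
Proof.
move=> sd; rewrite -big_filter (perm_big _ (smooths_dvd_perm X sd)).
by rewrite big_map.
Qed.

Lemma prod_primes_dvd (s : seq nat) m : uniq s -> all prime s ->
  all (dvdn^~ m) s -> (\prod_(p <- s) p %| m)%N.
Proof.
elim: s => [|p s IH]; first by rewrite big_nil dvd1n.
move=> /= /andP[ps us] /andP[pp aps] /andP[pm asm].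
rewrite big_cons Gauss_dvd ?pm ?IH//.
rewrite big_seq; elim/big_ind: _ => [|a b ca cb|q qs]; rewrite ?coprimen1 ?coprimeMr ?ca//.
rewrite prime_coprime// dvdn_prime2//; last exact: (allP aps).
by apply: contraNneq ps => ->.
Qed.

(** The distinct primes of [s] that divide [m] multiply to a divisor of [m], and each of them is at
    least [z]. *)
Lemma expn_count_dvd (s : seq nat) z m : (0 < m)%N -> uniq s -> all prime s ->
  all (leq z) s -> (z ^ count (dvdn^~ m) s <= m)%N.
Proof.
move=> m0 us ps zs; rewrite -size_filter.
set t := [seq p <- s | (p %| m)%N].
apply: (@leq_trans (\prod_(p <- t) p)); last first.
  apply: dvdn_leq => //; apply: prod_primes_dvd; rewrite ?filter_uniq ?filter_all//.
  by apply/allP => p; rewrite mem_filter => /andP[_ /(allP ps)].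
have : all (leq z) t.
  by apply/allP => p; rewrite mem_filter => /andP[_ /(allP zs)].
elim: t => [|p t IH]; first by rewrite big_nil.
by move=> /= /andP[zp zt]; rewrite big_cons expnS leq_mul// IH.
Qed.

Lemma lep_prime y p : prime p -> (p <= y)%N -> (lep y).-nat p.
Proof. by move=> pp py; rewrite pnatE. Qed.

(** Double counting of the pairs [(p, m)] with [p] dividing [m]: for fixed [p] they correspond to
    the smooth integers up to [X / p], and each [m] lies in at most [K] pairs. *)
Lemma sum_smooths_div (s : seq nat) X y K : all prime s -> all (geq y) s ->
  (forall m, m \in smooths X y -> (count (dvdn^~ m) s <= K)%N) ->
  (\sum_(p <- s) size (smooths (X %/ p) y) <= K * size (smooths X y))%N.
Proof.
move=> ps sy hK.
have -> : (\sum_(p <- s) size (smooths (X %/ p) y) =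
    \sum_(p <- s) \sum_(m <- smooths X y | (p %| m)%N) 1)%N.
  rewrite big_seq [RHS]big_seq; apply: eq_bigr => p ip.
  rewrite (sum_smooths_dvd (fun=> 1%N)) ?lep_prime ?(allP ps)//.
    by rewrite sum1_size.
  exact: (allP sy _ ip).
rewrite (exchange_big_dep xpredT)//= -sum1_size big_distrr/=.
rewrite big_seq [leqRHS]big_seq; apply: leq_sum => m im.
by rewrite sum1_count muln1 hK.
Qed.

(** * Chebyshev's lower bound for the number of primes, and smooth numbers up to X / D *)

Definition primes_upto (y : nat) : seq nat := [seq p <- iota 0 y.+1 | prime p].

Lemma mem_primes_upto y p : (p \in primes_upto y) = prime p && (p <= y)%N.
Proof. by rewrite mem_filter mem_iota ltnS. Qed.

Lemma primes_upto_uniq y : uniq (primes_upto y).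
Proof. by rewrite filter_uniq ?iota_uniq. Qed.

(** In Legendre's formula each power [p ^ i] contributes 0 or 1 to the exponent, and nothing once
    [p ^ i > 2n]. The case [n = 0] is set apart because there the prime power is 1 while [n.*2] is
    0. *)
Lemma logn_central_bin p n : prime p ->
  (p ^ logn p 'C(n.*2, n) <= n.*2)%N || (n == 0)%N.
Proof.
move=> pp; case: n => [|n]; first by rewrite orbT.
rewrite orbF; set N := n.+1.
have N0 : (0 < N.*2)%N by [].
apply: leq_trans (trunc_logP (prime_gt1 pp) N0).
rewrite leq_exp2l ?prime_gt1//.
have e : (logn p (N.*2)`! = logn p 'C(N.*2, N) + (logn p N`! + logn p N`!))%N.
  rewrite -(@bin_fact N.*2 N); last by rewrite -addnn leq_addr.
  rewrite lognM ?muln_gt0 ?fact_gt0 ?bin_gt0 -?addnn ?leq_addr//.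
  by rewrite addnK lognM ?fact_gt0.
set k := trunc_log p N.*2.
have hb (i M : nat) : (M <= N.*2)%N -> (k < i)%N -> (M %/ p ^ i = 0)%N.
  move=> MN ki; rewrite divn_small//; apply: (leq_ltn_trans MN).
  by apply: (leq_trans (trunc_log_ltn _ (prime_gt1 pp))); rewrite leq_exp2l ?prime_gt1.
have kN : (k <= N.*2)%N.
  rewrite -(leq_exp2l _ _ (prime_gt1 pp)).
  apply: (leq_trans (trunc_logP (prime_gt1 pp) N0)).
  by apply: ltnW; apply: ltn_expl; exact: prime_gt1.
(* Legendre's sum for the factorial of [M] runs up to [M]; cutting or padding zero terms brings all
   factorials to the common range up to [k]. *)
have lf M : (M <= N.*2)%N -> logn p M`! = (\sum_(1 <= i < k.+1) M %/ p ^ i)%N.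
  move=> MN; rewrite logn_fact//; case: (leqP k M) => kM.
    rewrite (big_cat_nat (n := k.+1))//= [X in (_ + X)%N]big_nat_cond.
    rewrite [X in (_ + X)%N]big1 ?addn0// => i /andP[/andP[ki _] _].
    exact: hb.
  rewrite [RHS](big_cat_nat (n := M.+1))//=; last by rewrite ltnS ltnW.
  rewrite [X in (_ + X)%N]big_nat_cond.
  rewrite [X in (_ + X)%N]big1 ?addn0// => i /andP[/andP[ki _] _].
  rewrite divn_small// (ltn_trans ki)// ltn_expl// prime_gt1//.
have h2 : (logn p (N.*2)`! <= k + (logn p N`! + logn p N`!))%N.
  rewrite !lf// -?addnn ?leq_addr//.
  have -> : (k + (\sum_(1 <= i < k.+1) N %/ p ^ i + \sum_(1 <= i < k.+1) N %/ p ^ i)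
    = \sum_(1 <= i < k.+1) 1 + (\sum_(1 <= i < k.+1) N %/ p ^ i + \sum_(1 <= i < k.+1) N %/ p ^ i))%N.
    by rewrite sum_nat_const_nat muln1 subn1.
  rewrite -!big_split/=; apply: leq_sum => i _.
  have pi0 : (0 < p ^ i)%N by rewrite expn_gt0 prime_gt0.
  rewrite -ltnS ltn_divLR//.
  have := ltn_ceil N pi0.
  nia.
by move: h2; rewrite e leq_add2r.
Qed.

Lemma prime_dvd_fact_leq p n : prime p -> (p %| n`!)%N -> (p <= n)%N.
Proof.
move=> pp; elim: n => [|n IH]; first by rewrite dvdn1 => /eqP p1; rewrite p1 in pp.
rewrite factS Euclid_dvdM// => /orP[/dvdn_leq->//|/IH/leqW//].
Qed.

Lemma exp2_le_central_bin n : (2 ^ n <= 'C(n.*2, n))%N.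
Proof.
elim: n => [|n IH]; first by rewrite bin0.
rewrite doubleS binS binS expnS mul2n -addnn.
by rewrite leq_add// (leq_trans IH)// ?leq_addl// leq_bin2l.
Qed.

(** The central binomial coefficient is at least [2 ^ n], its primes are at most [2n], and so is
    each prime power in its factorization. *)
Lemma exp2_le_primes n : (0 < n)%N ->
  (2 ^ n <= n.*2 ^ size (primes_upto n.*2))%N.
Proof.
move=> n0; apply: (leq_trans (exp2_le_central_bin n)).
set C := 'C(n.*2, n).
have C0 : (0 < C)%N by rewrite bin_gt0 -addnn leq_addr.
rewrite [leqLHS](prod_prime_decomp C0) prime_decompE big_map/=.
apply: (@leq_trans (\prod_(p <- primes C) n.*2)).
  rewrite big_seq [leqRHS]big_seq; apply: leq_prod => p.
  rewrite mem_primes => /and3P[pp _ _].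
  by have := logn_central_bin n pp; rewrite eqn0Ngt n0 orbF.
rewrite big_const_seq count_predT iter_muln muln1.
rewrite leq_exp2l; last by move: n0; clear; case: n => // n _; rewrite doubleS.
apply: uniq_leq_size; first exact: primes_uniq.
move=> p; rewrite mem_primes mem_primes_upto => /and3P[pp _ pC].
rewrite pp leqNgt; apply/negP => lt.
have : (p %| (n.*2)`!)%N.
  by rewrite -(@bin_fact n.*2 n) -?addnn ?leq_addr// addnn dvdn_mulr.
by move/(prime_dvd_fact_leq pp); rewrite leqNgt lt.
Qed.

Section real_lemmas.
Context {R : realType}.
Implicit Types (X y z n : nat).

Lemma ln2_ge : 2^-1 <= ln (2 : R).
Proof.
have : ln (2^-1 : R) <= - 2^-1.
  by have := @le_ln1Dx R (- 2^-1); rewrite (_ : 1 + - 2^-1 = 2^-1); [apply; lra|lra].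
by rewrite lnV ?posrE//; lra.
Qed.

Lemma ln_nat_ge0 n : 0 <= ln (n%:R : R).
Proof.
case: n => [|n]; first by rewrite ln0.
by rewrite ln_ge0// ler1n.
Qed.

Lemma le_ln_nat n m : (n <= m)%N -> ln (n%:R : R) <= ln (m%:R : R).
Proof.
case: n => [|n] nm; first by rewrite ln0 ?ln_nat_ge0.
by rewrite ler_ln ?posrE ?ltr0n ?ler_nat// (leq_trans _ nm).
Qed.

Lemma chebyshev y : (1 < y)%N ->
  y%:R / 8 <= (size (primes_upto y))%:R * ln (y%:R : R).
Proof.
move=> y1; set n := y./2.
have n0 : (0 < n)%N by rewrite /n half_gt0.
have ny : (n.*2 <= y)%N by rewrite -[leqRHS](odd_double_half y) leq_addl.
(* Here [y <= 2n + 1 <= 3n], so [n ln 2 >= n / 2 >= y / 6], which leaves room for the constant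
   1/8. *)
have yn : (y <= 3 * n)%N.
  rewrite -[leqLHS](odd_double_half y) -/n; move: n0; case: (odd y) => /=; lia.
have := exp2_le_primes n0.
rewrite -(ler_nat R) !natrX => h.
have {h} : ln (2 ^+ n : R) <= ln (n.*2%:R ^+ size (primes_upto n.*2)).
  by rewrite ler_ln ?posrE ?exprn_gt0 ?ltr0n ?double_gt0.
rewrite !lnXn ?ltr0n ?double_gt0// -[_ *+ n]mulr_natl -[_ *+ size _]mulr_natl.
move=> h; have l2 := ln2_ge.
have ynR : (y%:R : R) <= 3 * n%:R by rewrite -natrM ler_nat.
apply: (@le_trans _ _ ((n%:R : R) * ln 2)).
  have : (n%:R : R) * 2^-1 <= n%:R * ln 2 by rewrite ler_wpM2l.
  have : 0 <= n%:R :> R by [].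
  lra.
apply: (le_trans h); apply: ler_pM; rewrite ?ler0n ?ln_nat_ge0 ?le_ln_nat//.
rewrite ler_nat; apply: uniq_leq_size; first exact: primes_upto_uniq.
by move=> p; rewrite !mem_primes_upto => /andP[-> h']; rewrite (leq_trans h').
Qed.

Lemma powR_large (a C : R) : 0 < a -> exists2 x0 : R, 1 <= x0 &
  forall x, x0 <= x -> C <= x `^ a.
Proof.
move=> a0; exists (Num.max 1 (Num.max 1 C `^ a^-1)); first by rewrite le_max lexx.
move=> x; rewrite ge_max => /andP[x1 hx].
apply: (@le_trans _ _ ((Num.max 1 C `^ a^-1) `^ a)).
  by rewrite -powRrM mulVf ?gt_eqF// powRr1 ?le_max ?lexx ?ler01 ?orbT.
by apply: ge0_ler_powR; rewrite ?nnegrE ?powR_ge0 ?(ltW a0)// (le_trans ler01).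
Qed.

Lemma ln_le_powR (a C : R) : 0 < a -> exists2 x0 : R, 1 <= x0 &
  forall x, x0 <= x -> C * ln x <= x `^ a.
Proof.
move=> a0; have a20 : 0 < a / 2 by rewrite divr_gt0.
have [x0 x01 hx] := @powR_large (a / 2) (`|C| * (2 / a)) a20.
exists x0 => // x x0x; have x1 : 1 <= x by apply: le_trans x0x.
have xp : 0 < x by rewrite (lt_le_trans ltr01).
apply: (@le_trans _ _ (`|C| * ln x)); first by rewrite ler_wpM2r ?ln_ge0 ?ler_norm.
have h1 : a / 2 * ln x <= x `^ (a / 2).
  by rewrite -ln_powR ltW// ln_sublinear// powR_gt0.
have -> : x `^ a = x `^ (a / 2) * x `^ (a / 2).
  by rewrite -powRD ?(gt_eqF xp) ?implybT//; congr powR; lra.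
apply: (@le_trans _ _ (`|C| * (2 / a) * (a / 2 * ln x))).
  by rewrite mulrA -(mulrA `|C|) (_ : 2 / a * (a / 2) = 1) ?mulr1//; field; rewrite gt_eqF.
have l0 := ln_ge0 x1.
have d0 : 0 <= 2 / a by rewrite divr_ge0// ltW.
apply: ler_pM; [exact: mulr_ge0|exact: mulr_ge0 (ltW a20) l0|exact: hx|exact: h1].
Qed.

Lemma count_dvd_ln (s : seq nat) X y m z : (1 < z)%N -> uniq s -> all prime s ->
  all (leq z) s -> m \in smooths X y ->
  ln (z%:R : R) * (count (dvdn^~ m) s)%:R <= ln (X%:R).
Proof.
move=> z1 us ps zs; rewrite mem_smooths => /and3P[m0 mX _].
have X0 : (0 < X)%N by apply: leq_trans mX.
have := leq_trans (expn_count_dvd m0 us ps zs) mX.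
rewrite -(ler_nat R) natrX => h.
have {h} : ln ((z%:R : R) ^+ count (dvdn^~ m) s) <= ln X%:R.
  by rewrite ler_ln ?posrE ?exprn_gt0 ?ltr0n ?(ltnW z1).
by rewrite lnXn ?ltr0n ?(ltnW z1)// mulr_natr.
Qed.

(* Chebyshev's bound on the number of primes up to [y], against the fact that an
   integer up to [X] has at most [ln X / ln 2] prime factors. *)
Lemma smooths_step (mu sigma : R) : 0 <= mu -> mu + sigma < 1 ->
  exists y0 : nat, forall X y, (y0 <= y)%N -> ln X%:R <= y%:R `^ mu ->
  (size (smooths (X %/ y) y))%:R * y%:R `^ sigma <= (size (smooths X y))%:R :> R.
Proof.
move=> mu0 ms.
have [x0 x01 hx] := @ln_le_powR (1 - mu - sigma) 16 ltac:(lra).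
exists (maxn 2 (Num.truncn x0).+1) => X y; rewrite geq_max => /andP[y2 yx] lX.
have y0 : 0 < y%:R :> R by rewrite ltr0n ltnW.
have {}hx : 16 * ln (y%:R : R) <= y%:R `^ (1 - mu - sigma).
  apply: hx; apply: ltW; apply: (lt_le_trans (truncnS_gt _)).
  by rewrite ler_nat.
have cX := chebyshev y2.
case: (posnP X) => [->|X0].
  by rewrite div0n /= mul0r.
pose s := primes_upto y.
(* Since [ln 2 >= 1/2] and [ln X <= y ^ mu], an integer up to [X] has at most [2 y ^ mu] prime
   factors. *)
pose K := Num.truncn (2 * (y%:R : R) `^ mu).
have sp : all prime s by apply/allP => p; rewrite mem_primes_upto => /andP[].
have sy : all (geq y) s by apply/allP => p; rewrite mem_primes_upto => /andP[].
have hK m : m \in smooths X y -> (count (dvdn^~ m) s <= K)%N.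
  move=> im; rewrite truncn_ge_nat ?mulr_ge0 ?powR_ge0//.
  have s2 : all (leq 2) s by apply/allP => p /(allP sp)/prime_gt1.
  have := @count_dvd_ln s X y m 2 isT (primes_upto_uniq y) sp s2 im.
  have := ln2_ge; set c := (count _ _)%:R => l2 hc.
  have c0 : 0 <= c by [].
  have : 2^-1 * c <= ln 2 * c by rewrite ler_wpM2r.
  lra.
have H := sum_smooths_div sp sy hK.
have {H} : (size s * size (smooths (X %/ y) y) <= K * size (smooths X y))%N.
  apply: leq_trans H; rewrite -sum1_size big_distrl/= big_seq [leqRHS]big_seq.
  apply: leq_sum => p ps; rewrite mul1n leq_smooths// leq_div2l//.
    by rewrite prime_gt0// (allP sp).
  exact: (allP sy).
rewrite -(ler_nat R) !natrM => H.
set A := (size (smooths (X %/ y) y))%:R in H *.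
set B := (size (smooths X y))%:R in H *.
have A0 : 0 <= A by []. have B0 : 0 <= B by [].
have Kle : K%:R <= 2 * (y%:R : R) `^ mu by rewrite truncn_le mulr_ge0 ?powR_ge0.
have L0 : 0 < ln (y%:R : R) by rewrite ln_gt0 ?ltr1n.
have h1 : y%:R / 8 * A <= 2 * y%:R `^ mu * B * ln (y%:R : R).
  apply: (@le_trans _ _ ((size s)%:R * ln (y%:R : R) * A)); first by rewrite ler_wpM2r.
  rewrite mulrAC; rewrite ler_wpM2r ?(ltW L0)//; apply: (le_trans H).
  by rewrite ler_wpM2r.
(* The middle factor is the slack in [mu + sigma < 1]; it absorbs [16 ln y], where 8 comes from
   Chebyshev's bound and 2 from [K]. *)
have e : (y%:R : R) = y%:R `^ mu * y%:R `^ (1 - mu - sigma) * y%:R `^ sigma.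
  rewrite -!powRD ?(gt_eqF y0) ?implybT//.
  by rewrite (_ : mu + _ + sigma = 1) ?powRr1 ?(ltW y0)//; lra.
have pm0 : 0 < (y%:R : R) `^ mu by rewrite powR_gt0.
set T := (y%:R : R) `^ sigma in e *. set U := (y%:R : R) `^ mu in e h1 pm0 *.
set V := (y%:R : R) `^ (1 - mu - sigma) in e hx *.
have V0 : 0 < V by rewrite powR_gt0.
have h2 : 16 * ln (y%:R : R) * (A * T) <= 16 * ln (y%:R : R) * B.
  apply: (@le_trans _ _ (V * (A * T))).
    by rewrite ler_wpM2r// mulr_ge0 ?powR_ge0.
  rewrite -(ler_pM2l pm0).
  have -> : U * (V * (A * T)) = y%:R * A by rewrite [in RHS]e; ring.
  have -> : U * (16 * ln y%:R * B) = 8 * (2 * U * B * ln (y%:R : R)) by ring.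
  lra.
by move: h2; rewrite ler_pM2l// mulr_gt0.
Qed.

(** Iterating [smooths_step] settles the powers of [y]. For [D] between two of them, the lower one
    bounds the count and the upper one the weight, at a cost of [y ^ sigma <= y]. *)
Lemma smooths_ratio (mu sigma : R) : 0 <= mu -> 0 <= sigma <= 1 -> mu + sigma < 1 ->
  exists y0 : nat, forall X y, (y0 <= y)%N -> ln X%:R <= y%:R `^ mu ->
  forall D, (size (smooths (X %/ D) y))%:R * D%:R `^ sigma
            <= y%:R * (size (smooths X y))%:R :> R.
Proof.
move=> mu0 /andP[s0 s1] ms; have [y0 hy] := smooths_step mu0 ms.
exists (maxn 2 y0) => X y; rewrite geq_max => /andP[y2 yy] lX D.
have yp : 0 < y%:R :> R by rewrite ltr0n ltnW.
have H k : (size (smooths (X %/ y ^ k) y))%:R * (y ^ k)%:R `^ sigma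
   <= (size (smooths X y))%:R :> R.
  elim: k => [|k IH]; first by rewrite expn0 divn1 powR1 mulr1.
  apply: le_trans IH; rewrite expnSr divnMA natrM powRM// mulrA mulrAC.
  rewrite ler_wpM2r ?powR_ge0// hy//; apply: le_trans lX.
  by rewrite le_ln_nat// leq_div.
case: (posnP D) => [->|D0].
  rewrite divn0 /= mul0r mulr_ge0//.
set k := trunc_log y D.
have kD : (y ^ k <= D)%N by apply: trunc_logP.
have Dk : (D <= y ^ k.+1)%N by rewrite ltnW// trunc_log_ltn.
apply: (@le_trans _ _ ((size (smooths (X %/ y ^ k) y))%:R * (y ^ k.+1)%:R `^ sigma)).
  apply: ler_pM; rewrite ?powR_ge0//.
    by rewrite ler_nat leq_smooths// leq_div2l// expn_gt0 (ltnW y2).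
  by apply: ge0_ler_powR; rewrite ?nnegrE// ler_nat.
rewrite expnSr natrM powRM// mulrA mulrC ler_pM ?mulr_ge0 ?powR_ge0//.
by apply: ler1_powR => //; rewrite ler1n ltnW.
Qed.

End real_lemmas.

(** * Positive density of the smooth numbers when X <= y ^ k *)

Section density.
Context {R : realType}.
Implicit Types (X y z n : nat).

Lemma natr_divn_le X d : (X %/ d)%:R <= X%:R / d%:R :> R.
Proof.
case: (posnP d) => [->|d0]; first by rewrite divn0 invr0 mulr0.
by rewrite ler_pdivlMr ?ltr0n// -natrM ler_nat leq_trunc_div.
Qed.

Lemma natr_divn_ge X d : (0 < d)%N -> (d <= X)%N ->
  X%:R / d%:R / 2 <= (X %/ d)%:R :> R.
Proof.
move=> d0 dX; rewrite ler_pdivrMr// ler_pdivrMr ?ltr0n// -!natrM ler_nat.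
have := ltn_ceil X d0; have : (0 < X %/ d)%N by rewrite divn_gt0.
set q := (X %/ d)%N; rewrite mulSn; nia.
Qed.

(* Partial summation of Chebyshev's lower bound; the [z] primes up to [z] are
   negligible from [z ^ 2] on. *)
Lemma sum_inv_primes_ge : exists z0 : nat, forall z y, (z0 <= z)%N -> (z ^ 6 <= y)%N ->
  32^-1 <= \sum_(p <- primes_upto y | (z < p)%N) (p%:R : R)^-1.
Proof.
have [x0 x01 hx] := @ln_le_powR R 2^-1 16 ltac:(lra).
exists (maxn 2 (Num.truncn x0).+1) => z y; rewrite geq_max => /andP[z2 zx] zy.
have z0 : (0 < z)%N by apply: ltnW.
have zz2 : (z ^ 2 <= y)%N by rewrite (leq_trans _ zy)// leq_exp2l.
pose P := [seq p <- primes_upto y | (z < p)%N].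
have yz : (z < y)%N by apply: leq_trans zz2; rewrite -[X in (X < _)%N]expn1 ltn_exp2l.
have y0 : (0 < y)%N by apply: leq_ltn_trans yz.
(* Discarding the primes up to [z] at most halves Chebyshev's [n / (8 ln n)]; then [ln n] is
   enlarged to [ln y], which does not depend on [n]. *)
have pi_ge n : (z ^ 2 <= n)%N -> (n <= y)%N ->
    n%:R / (16 * ln y%:R) <= (count (geq n) P)%:R :> R.
  move=> zn ny.
  have zn' : (z < n)%N by apply: leq_trans zn; rewrite -[X in (X < _)%N]expn1 ltn_exp2l.
  have n1 : (1 < n)%N by apply: leq_trans zn'; rewrite ltnS.
  have n0R : 0 < n%:R :> R by rewrite ltr0n ltnW.
  have L0 : 0 < ln (n%:R : R) by rewrite ln_gt0 ?ltr1n.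
  have hc : (size (primes_upto n) <= z + count (geq n) P)%N.
    rewrite -(count_predC (geq z) (primes_upto n)) leq_add//.
      rewrite -size_filter -[leqRHS](size_iota 1).
      apply: uniq_leq_size; first by rewrite filter_uniq ?primes_upto_uniq.
      move=> p; rewrite mem_filter mem_primes_upto mem_iota add1n ltnS => /and3P[/= -> /prime_gt0 -> _] //.
    rewrite -!size_filter; apply: uniq_leq_size; first by rewrite filter_uniq ?primes_upto_uniq.
    move=> p; rewrite !mem_filter !mem_iota /= !ltnS -ltnNge => /and3P[-> -> pn].
    by rewrite pn (leq_trans pn).
  have hz : z%:R <= n%:R / (16 * ln n%:R) :> R.
    rewrite ler_pdivlMr ?mulr_gt0//.
    have := hx n%:R; rewrite powR12_sqrt// => hh.
    have {}hh : 16 * ln n%:R <= Num.sqrt (n%:R : R).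
      apply: hh; apply: ltW; apply: (lt_le_trans (truncnS_gt _)).
      by rewrite ler_nat (leq_trans zx)// ltnW.
    have hs : z%:R <= Num.sqrt (n%:R : R).
      by rewrite -(ler_pXn2r (n := 2))// ?nnegrE ?sqrtr_ge0// sqr_sqrtr// -natrX ler_nat.
    apply: (@le_trans _ _ (Num.sqrt (n%:R : R) * Num.sqrt n%:R)).
      by apply: ler_pM => //; rewrite mulr_ge0// ltW.
    by rewrite -expr2 sqr_sqrtr.
  have := chebyshev (R := R) n1; rewrite -(ler_pM2r (x := (ln n%:R)^-1)) ?invr_gt0//.
  rewrite mulfK ?gt_eqF// => hch.
  have hcR : (size (primes_upto n))%:R <= z%:R + (count (geq n) P)%:R :> R.
    by rewrite -natrD ler_nat.
  apply: (@le_trans _ _ (n%:R / (16 * ln (n%:R : R)))).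
    rewrite ler_pM2l// lef_pV2 ?posrE ?mulr_gt0 ?ln_gt0 ?ltr1n ?(leq_trans n1)//.
    by rewrite ler_pM2l// le_ln_nat.
  have e : n%:R / 8 / ln n%:R = 2 * (n%:R / (16 * ln (n%:R : R))).
    by field; rewrite gt_eqF.
  rewrite e in hch; move: hch hz hcR; set u := _ / _; lra.
(* Abel summation by telescoping: [1 / p] is at least the sum of [w n] over [p <= n <= y], so
   exchanging the sums leaves [w n] times a count of primes. *)
pose w (n : nat) : R := n%:R^-1 - n.+1%:R^-1.
have w0 n : (0 < n)%N -> 0 <= w n.
  move=> n0; rewrite subr_ge0 lef_pV2 ?posrE ?ltr0n// ler_nat//.
have wE n : (0 < n)%N -> w n * n%:R = n.+1%:R^-1.
  move=> n0; rewrite /w; have := n0; rewrite -(ltr0n R) => n0R.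
  rewrite -natr1; field.
  by rewrite gt_eqF// gt_eqF// ltr_wpDl// ltW.
rewrite -big_filter -/P.
apply: (@le_trans _ _ (\sum_(p <- P) \sum_(z ^ 2 <= n < y.+1 | (p <= n)%N) w n)); last first.
  rewrite big_seq [leRHS]big_seq; apply: ler_sum => p.
  rewrite mem_filter mem_primes_upto => /and3P[zp pp py].
  apply: (@le_trans _ _ (\sum_(p <= n < y.+1) w n)).
    have e2 : \sum_(p <= n < y.+1) w n = \sum_(0 <= n < y.+1 | (p <= n)%N) w n.
      rewrite [RHS](big_cat_nat (n := p))//=; last by rewrite leqW.
      rewrite [X in _ = X + _]big_nat_cond [X in _ = X + _]big1 ?add0r; last first.
        by move=> i; lia.
      rewrite big_nat_cond [RHS]big_nat_cond; apply: eq_bigl => i.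
      by case: (leqP p i).
    rewrite e2 [leRHS](big_cat_nat (n := z ^ 2))//=; last by rewrite leqW.
    rewrite lerDr; apply: sumr_ge0 => i pi; apply: w0; apply: leq_trans pi.
    exact: prime_gt0.
  rewrite (eq_bigr (fun n => (- n.+1%:R^-1) - (- n%:R^-1 : R))); last first.
    by move=> i _; rewrite /w opprK addrC.
  by rewrite (telescope_sumr (fun n => - n%:R^-1 : R)) ?leqW// opprK gerDr oppr_le0 invr_ge0.
rewrite (exchange_big_dep xpredT)//=.
have L0 : 0 < ln (y%:R : R) by rewrite ln_gt0 ?ltr1n ?(leq_ltn_trans z0 yz).
(* Now [w n * n = 1 / (n + 1)] dominates [ln (n + 2) - ln (n + 1)], which telescopes. *)
apply: (@le_trans _ _ (\sum_(z ^ 2 <= n < y.+1) (16 * ln (y%:R : R))^-1 * (ln n.+2%:R - ln n.+1%:R))); last first.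
  apply: ler_sum_nat => n; rewrite ltnS => /andP[zn ny].
  have n0 : (0 < n)%N by apply: leq_trans zn; rewrite expn_gt0 z0.
  have n0R : 0 < n%:R :> R by rewrite ltr0n.
  rewrite big_const_seq iter_addr addr0 -[w n *+ _]mulr_natr.
  apply: (@le_trans _ _ (w n * (n%:R / (16 * ln (y%:R : R))))); last first.
    by rewrite ler_wpM2l ?w0// pi_ge.
  rewrite mulrA wE// [leRHS]mulrC ler_wpM2l ?invr_ge0 ?mulr_ge0 ?(ltW L0)//.
  rewrite -ln_div ?posrE ?ltr0n//.
  have -> : n.+2%:R / n.+1%:R = 1 + n.+1%:R^-1 :> R.
    by rewrite -[n.+2%:R]natr1 mulrDl mul1r divff.
  by apply: le_ln1Dx; apply: (@lt_le_trans _ _ 0); rewrite ?invr_ge0 ?ltrN10.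
rewrite -mulr_sumr telescope_sumr ?leqW//.
rewrite mulrC ler_pdivlMr ?mulr_gt0//.
(* Since [y >= z ^ 6], the logarithms leave at least [ln y - 3 ln z >= (ln y) / 2]; dividing by
   [16 ln y] gives 1/32. *)
have h1 : ln ((z ^ 2).+1%:R : R) <= 3 * ln z%:R.
  rewrite -[X in X * _]/(3%:R) mulr_natl -lnXn ?ltr0n// -natrX le_ln_nat//.
  by rewrite (expnS z 2); have := z2; have := sqrn_gt0 z; rewrite z0; nia.
have h2 : 6 * ln (z%:R : R) <= ln y%:R.
  rewrite -[X in X * _]/(6%:R) mulr_natl -lnXn ?ltr0n// -natrX le_ln_nat//.
have h3 : ln (y%:R : R) <= ln y.+2%:R by rewrite le_ln_nat// leqW.
move: h1 h2 h3; lra.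
Qed.

(** Induction on [j] in [X <= y z ^ j], with [y] between [z ^ 6] and [z ^ 12]. A prime [p > z]
    lowers [X] to [X / p <= y z ^ (j - 1)]; the reciprocals of the primes in [(z, y]] sum to at
    least 1/32, and an [m <= X] has boundedly many such prime factors. *)
Lemma smooths_density k : exists2 c : R, 0 < c & exists X0 : nat, forall X y,
  (X0 <= X)%N -> (X <= y ^ k)%N -> c * X%:R <= (size (smooths X y))%:R.
Proof.
have [z0 hz] := sum_inv_primes_ge.
have key j : exists2 c : R, 0 < c <= 1 & forall z y, (maxn 2 z0 <= z)%N ->
    (z ^ 6 <= y)%N -> (y <= z ^ 12)%N -> forall X, (X <= y * z ^ j)%N ->
    c * X%:R <= (size (smooths X y))%:R.
  elim: j => [|j [c /andP[c0 c1] IH]].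
    exists 1 => [|z y _ _ _ X]; first by rewrite ltr01 lexx.
    by rewrite expn0 muln1 mul1r => Xy; rewrite smooths_all// size_iota.
  (* The 64 is 32 times 2, the 2 paying for the integer part of [X / p]. At most [13 + j] primes
     above [z] divide [m], because [m <= y z ^ (j + 1) <= z ^ (13 + j)]. *)
  pose d : R := (64 * (13 + j)%:R)^-1.
  have d0 : 0 < d by rewrite invr_gt0 mulr_gt0.
  have d1 : d <= 1.
    rewrite invf_le1 ?mulr_gt0// (@le_trans _ _ 64)// ?ler1n// -[leLHS]mulr1.
    by rewrite ler_pM2l// ler1n.
  exists (c * d) => [|z y zz zy yz X hX]; first by rewrite mulr_gt0//= mulr_ile1// ltW.
  have := zz; rewrite geq_max => /andP[z2 z0z].
  case: (leqP X y) => [Xy|yX].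
    rewrite smooths_all// size_iota -[leRHS]mul1r ler_wpM2r// mulr_ile1// ltW//.
  pose P := [seq p <- primes_upto y | (z < p)%N].
  have Pp : all prime P.
    by apply/allP => p; rewrite mem_filter mem_primes_upto => /and3P[].
  have Py : all (geq y) P.
    by apply/allP => p; rewrite mem_filter mem_primes_upto => /and3P[].
  have Pz : all (leq z) P.
    by apply/allP => p; rewrite mem_filter mem_primes_upto => /and3P[/ltnW].
  have uP : uniq P by rewrite filter_uniq ?primes_upto_uniq.
  have hK m : m \in smooths X y -> (count (dvdn^~ m) P <= 13 + j)%N.
    rewrite mem_smooths => /and3P[m0 mX _].
    rewrite -(leq_exp2l _ _ z2) (leq_trans (expn_count_dvd m0 uP Pp Pz))//.
    rewrite (leq_trans mX)// (leq_trans hX)// (_ : (13 + j = 12 + j.+1)%N)//.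
    by rewrite expnD leq_mul2r yz orbT.
  have := sum_smooths_div Pp Py hK; rewrite -(ler_nat R) natrM natr_sum => H.
  rewrite /d mulrAC ler_pdivrMr ?mulr_gt0//.
  suff : c * X%:R * (32^-1 / 2) <= \sum_(p <- P) (size (smooths (X %/ p) y))%:R.
    by move=> h; move: (le_trans h H); set K := (13 + j)%:R; clearbody K; lra.
  apply: (@le_trans _ _ (\sum_(p <- P) c * X%:R / 2 * p%:R^-1)).
    rewrite -mulr_sumr big_filter; have := hz z y z0z zy.
    have : 0 <= c * X%:R by rewrite mulr_ge0// ltW.
    set u := c * _; set v := \sum_(_ <- _ | _) _ => u0 hv.
    rewrite (_ : u * (32^-1 / 2) = u / 2 * 32^-1); last by ring.
    by rewrite ler_wpM2l// divr_ge0.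
  rewrite big_seq [leRHS]big_seq; apply: ler_sum => p ip.
  have pp := allP Pp _ ip; have py : (p <= y)%N := allP Py _ ip.
  have zp : (z <= p)%N := allP Pz _ ip.
  apply: (@le_trans _ _ (c * (X %/ p)%:R)); last first.
    apply: (IH z) => //; rewrite -(leq_pmul2r (prime_gt0 pp)).
    apply: (leq_trans (leq_trunc_div _ _)); apply: (leq_trans hX).
    by rewrite expnSr mulnA leq_mul2l zp orbT.
  rewrite -!mulrA ler_pM2l// [2^-1 * _]mulrC mulrA natr_divn_ge ?prime_gt0//.
  by rewrite (leq_trans py)// ltnW.
have [c /andP[c0 c1] hc] := key (12 * k)%N.
exists c => //; set Z := maxn 2 z0.
exists (Z ^ (6 * k)).+1 => X y ZX Xy.
have Zy : (Z ^ 6 <= y)%N.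
  rewrite leqNgt; apply/negP => yZ; move: ZX; rewrite ltnNge (leq_trans Xy)//.
  case: (posnP k) => [->|k0]; first by rewrite muln0.
  by rewrite expnM leq_exp2r// ltnW.
have y0 : (0 < y)%N by apply: leq_trans Zy; rewrite expn_gt0 leq_max.
(* The largest [z] with [z ^ 6 <= y] also satisfies [y < (z + 1) ^ 6 <= z ^ 12]. *)
pose P z := (z ^ 6 <= y)%N.
have exP : exists z, P z by exists Z.
have bP z : P z -> (z <= y)%N.
  by move=> h; apply: leq_trans h; rewrite -[leqLHS]expn1; case: z => // z; rewrite leq_pexp2l.
case: (ex_maxnP exP bP) => z Pz maxz.
have Zz : (Z <= z)%N by apply: maxz.
have z2 : (2 <= z)%N by apply: leq_trans Zz; rewrite leq_max.
have yz : (y <= z ^ 12)%N.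
  have : (y < z.+1 ^ 6)%N by rewrite ltnNge; apply/negP => /maxz; rewrite ltnn.
  move=> /ltnW h; apply: (leq_trans h); rewrite (_ : 12 = 2 * 6)%N// expnM.
  rewrite leq_exp2r//; nia.
apply: (hc z) => //; apply: (leq_trans Xy).
apply: (@leq_trans (z ^ (12 * k))); last by rewrite leq_pmull.
case: (posnP k) => [->|k0]; first by rewrite muln0.
by rewrite expnM leq_exp2r.
Qed.

End density.

(** * Trigonometric sums and equidistribution *)

Section trigonometric_sums.
Context {R : realType}.
Implicit Types (t x phi r : R) (k : int).

Lemma cosD2pin x (n : nat) : cos (x + 2 * pi * n%:R) = cos x :> R.
Proof.
have := periodicn (@cosD2pi R) n x.
by rewrite (_ : pi *+ 2 *+ n = 2 * pi * n%:R)// mulr_natl mulr_natr.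
Qed.

Lemma cosD2piz x k : cos (x + 2 * pi * k%:~R) = cos x :> R.
Proof.
case: k => n; first exact: cosD2pin.
by rewrite NegzE mulrNz mulrN -[LHS](cosD2pin _ n.+1) subrK.
Qed.

Lemma sinpi_sqr t : sin (pi * t) ^+ 2 = (1 - cos (2 * pi * t)) / 2 :> R.
Proof.
have -> : 2 * pi * t = (pi * t) *+ 2 by rewrite -mulr_natl; ring.
by rewrite cos_mulr2n cos2sin2; field.
Qed.

Lemma norm_sinpiDz t k : `|sin (pi * (t + k%:~R))| = `|sin (pi * t)| :> R.
Proof.
rewrite -!sqrtr_sqr; congr Num.sqrt; rewrite !sinpi_sqr.
by rewrite mulrDr cosD2piz.
Qed.

(** Mean value theorem up to [t = 1/4], where the cosine is at least 1/2, and monotonicity from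
    there on. *)
Lemma sinpi_ge t : 0 <= t <= 2^-1 -> t / 2 <= sin (pi * t) :> R.
Proof.
move=> /andP[t0 t1]; have pi2 := @pi_ge2 R; have pi4 : pi < 4 :> R by have := @pihalf_lt2 R; lra.
pose q : R := pi / 4.
have sq : sin q ^+ 2 = 2^-1 :> R.
  rewrite /q sinpi_sqr (_ : 2 * pi * 4^-1 = pi / 2); last by field.
  by rewrite cos_pihalf; field.
have sq0 : 0 < sin q :> R by apply: sin_gt0_pihalf; rewrite /q; lra.
have cq : 2^-1 <= cos q :> R.
  have c0 : 0 <= cos q :> R by apply: cos_ge0_pihalf; rewrite /q; lra.
  have := cos2sin2 q; rewrite sq => h.
  rewrite leNgt; apply/negP => h2; nra.
have sq1 : 4^-1 <= sin q :> R by rewrite leNgt; apply/negP => h2; nra.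
have inI x : 0 <= x <= 2^-1 -> pi * x \in `[(- (pi / 2)), pi / 2]%R.
  move=> /andP[x0 x1]; rewrite in_itv/=; apply/andP; split.
    by apply: (@le_trans _ _ 0); [lra|rewrite mulr_ge0//; lra].
  by rewrite ler_wpM2l//; lra.
case: (lerP t 4^-1) => tq; last first.
  apply: (@le_trans _ _ (sin q)); first lra.
  by rewrite ltW// ltr_sin ?inI ?ltr_pM2l ?pi_gt0//; lra.
case: (ltrgtP t 0) t0 => // [t0 _|-> _]; last by rewrite mulr0 sin0 mul0r.
have pt0 : 0 < pi * t by rewrite mulr_gt0//; lra.
have [c] := @MVT R sin cos 0 (pi * t) pt0 (fun x _ => is_derive_sin x)
  (continuous_subspaceT (@continuous_sin R)).
rewrite in_itv/= => /andP[c0 c1]; rewrite sin0 !subr0 => ->.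
have ptq : pi * t <= q by rewrite /q; nra.
have : cos q <= cos c.
  by rewrite ltW// ltr_cos ?in_itv/=; rewrite /q in ptq *; lra.
nra.
Qed.

Lemma norm_sinpi_ge t r : (forall k, r <= `|t - k%:~R|) -> r / 2 <= `|sin (pi * t)|.
Proof.
move=> h; set u := t - (Num.floor t)%:~R.
have -> : t = u + (Num.floor t)%:~R by rewrite subrK.
rewrite norm_sinpiDz.
have u0 : 0 <= u by rewrite subr_ge0 floor_le_tmp.
have u1 : u < 1 by rewrite ltrBlDr addrC -[1]/(1%:~R) -intrD floorD1_gt.
have h0 := h (Num.floor t); rewrite ger0_norm// -/u in h0.
have h1 := h (Num.floor t + 1).
rewrite intrD opprD addrA -/u ler0_norm in h1; last by lra.
case: (lerP u 2^-1) => u2.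
  apply: le_trans (ler_norm _); apply: le_trans (sinpi_ge _); lra.
rewrite -normrN -sinN -mulrN -(norm_sinpiDz _ 1).
apply: le_trans (ler_norm _); apply: le_trans (sinpi_ge _); rewrite /=; lra.
Qed.

(** Multiplication by [2 sin (pi t)] turns each term into a difference of consecutive sines. *)
Lemma sum_cos_geom t phi (u v : nat) : (u <= v)%N ->
  2 * sin (pi * t) * \sum_(u <= b < v) cos (2 * pi * (b%:R * t) + phi) =
  sin (pi * ((2 * v%:R - 1) * t) + phi) - sin (pi * ((2 * u%:R - 1) * t) + phi).
Proof.
move=> uv; rewrite mulr_sumr.
rewrite -(telescope_sumr (fun b => sin (pi * ((2 * b%:R - 1) * t) + phi)))//.
apply: eq_bigr => b _.
have -> : pi * ((2 * b.+1%:R - 1) * t) + phi = (2 * pi * (b%:R * t) + phi) + pi * t.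
  by rewrite -natr1; ring.
have -> : pi * ((2 * b%:R - 1) * t) + phi = (2 * pi * (b%:R * t) + phi) - pi * t by ring.
by rewrite sinD sinB; ring.
Qed.

Lemma norm_sum_cos_le t phi r (u v : nat) : 0 < r ->
  (forall k, r <= `|t - k%:~R|) ->
  `|\sum_(u <= b < v) cos (2 * pi * (b%:R * t) + phi)| <= 2 / r.
Proof.
move=> r0 hr; case: (leqP u v) => uv; last first.
  by rewrite big_geq ?normr0 ?divr_ge0 ?(ltW r0)// ltnW.
have h := norm_sinpi_ge hr.
have := sum_cos_geom t phi uv; set S := \sum_(_ <= _ < _) _ => e.
rewrite ler_pdivlMr//.
have : `|2 * sin (pi * t) * S| <= 2.
  rewrite e; apply: (le_trans (ler_normB _ _)).
  by apply: (le_trans (lerD (sin_max _) (sin_max _))); lra.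
rewrite !normrM (ger0_norm (_ : 0 <= 2))//.
have := normr_ge0 S; nra.
Qed.

(** The double sum is the squared modulus of the sum of [exp(i x)]; the left side is the square of
    the real part of that sum after a rotation by [phi]. *)
Lemma sqr_sum_cos_le (I : Type) (s : seq I) (x : I -> R) phi :
  (\sum_(i <- s) cos (x i + phi)) ^+ 2 <=
  \sum_(i <- s) \sum_(j <- s) cos (x i - x j).
Proof.
have -> : \sum_(i <- s) \sum_(j <- s) cos (x i - x j) =
   (\sum_(i <- s) cos (x i + phi)) ^+ 2 + (\sum_(i <- s) sin (x i + phi)) ^+ 2.
  rewrite !expr2 !mulr_suml -big_split/=; apply: eq_bigr => i _.
  rewrite !mulr_sumr -big_split/=; apply: eq_bigr => j _.
  by rewrite -cosB; congr cos; ring.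
by rewrite lerDl sqr_ge0.
Qed.

End trigonometric_sums.

(** * Fejer kernels and counting in arcs *)

Section fejer.
Context {R : realType}.
Implicit Types (t x phi r : R) (k : int).
Variable H : nat.

(* H times the Fejer kernel. *)
Definition fejer t : R :=
  \sum_(0 <= i < H) \sum_(0 <= j < H) cos (2 * pi * (i%:R * t) - 2 * pi * (j%:R * t)).

(** A squared modulus split into real and imaginary parts. The shift by [pi / 2] turns the cosine
    into a sine, so bounds for cosine sums with a free phase serve both. *)
Lemma fejerE t phi : fejer t = (\sum_(0 <= i < H) cos (2 * pi * (i%:R * t) + phi)) ^+ 2
  + (\sum_(0 <= i < H) cos (2 * pi * (i%:R * t) + (phi - pi / 2))) ^+ 2.
Proof.
rewrite !expr2 !mulr_suml -big_split/=; apply: eq_bigr => i _.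
rewrite !mulr_sumr -big_split/=; apply: eq_bigr => j _.
by rewrite !addrA !cosBpihalf -cosB; congr cos; ring.
Qed.

Lemma fejer_ge0 t : 0 <= fejer t.
Proof. by rewrite (fejerE t 0) addr_ge0 ?sqr_ge0. Qed.

Lemma fejer_le t r : 0 < r -> (forall k, r <= `|t - k%:~R|) -> fejer t <= 8 / r ^+ 2.
Proof.
move=> r0 hr; rewrite (fejerE t 0).
have h phi : (\sum_(0 <= i < H) cos (2 * pi * (i%:R * t) + phi)) ^+ 2 <= (2 / r) ^+ 2.
  rewrite -[leLHS]real_normK ?num_real// lerXn2r ?nnegrE ?divr_ge0 ?(ltW r0)//.
  exact: norm_sum_cos_le.
apply: (le_trans (lerD (h _) (h _))).
by rewrite expr_div_n -mulrDl ler_pM2r ?invr_gt0 ?exprn_gt0//; lra.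
Qed.

(** Orthogonality of roots of unity: the terms are real parts of a geometric progression whose ratio
    is an [H]-th root of unity other than 1. *)
Lemma sum_cos_roots (i j : nat) t : (i < H)%N -> (j < H)%N -> i != j ->
  \sum_(0 <= n < H) cos (2 * pi * (i%:R * (t - n%:R / H%:R))
     - 2 * pi * (j%:R * (t - n%:R / H%:R))) = 0 :> R.
Proof.
move=> iH jH ij; have H0 : (0 < H)%N by apply: leq_ltn_trans iH.
have H0R : 0 < H%:R :> R by rewrite ltr0n.
pose a : R := (j%:R - i%:R) / H%:R.
rewrite (eq_bigr (fun n => cos (2 * pi * (n%:R * a) + 2 * pi * ((i%:R - j%:R) * t)))); last first.
  by move=> n _; congr cos; rewrite /a; field; rewrite gt_eqF.
have := sum_cos_geom a (2 * pi * ((i%:R - j%:R) * t)) (leq0n H).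
set S := \sum_(_ <= _ < _) _ => e.
have : 2 * sin (pi * a) * S = 0.
  rewrite e; apply/eqP; rewrite subr_eq0; apply/eqP.
  rewrite -2!cosBpihalf.
  rewrite -[RHS](cosD2piz _ (j%:Z - i%:Z)); congr cos.
  rewrite intrB -!pmulrn /a; field; by rewrite gt_eqF.
move/eqP; rewrite mulf_eq0 => /orP[|/eqP//].
rewrite mulf_eq0 pnatr_eq0/= => /eqP sa.
suff : H%:R^-1 / 2 <= `|sin (pi * a)|.
  by rewrite sa normr0 pmulr_lle0// invr_le0 leNgt H0R.
apply: norm_sinpi_ge => k; rewrite /a.
have -> : (j%:R - i%:R) / H%:R - k%:~R = (j%:Z - i%:Z - k * H%:Z)%:~R / H%:R :> R.
  by rewrite !intrB intrM -!pmulrn; field; rewrite gt_eqF.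
rewrite normrM normfV (gtr0_norm H0R) -[leLHS]mul1r ler_pM2r ?invr_gt0//.
rewrite -intr_norm ler1z.
rewrite -gtz0_ge1 normr_gt0; apply/negP => /eqP h.
have ek : (j%:Z - i%:Z = k * H%:Z)%R by lia.
have [k0|k0] : k = 0 \/ 1 <= `|k| by lia.
  by rewrite k0 in ek; lia.
have : `|k| * H%:Z = `|j%:Z - i%:Z| by rewrite ek normrM.
have : H%:Z <= `|k| * H%:Z by rewrite ler_peMl.
lia.
Qed.

Lemma sum_fejer_shift t : \sum_(0 <= n < H) fejer (t - n%:R / H%:R) = H%:R ^+ 2.
Proof.
rewrite /fejer exchange_big/=.
transitivity (\sum_(0 <= i < H) (H%:R : R)).
  apply: eq_big_nat => i /andP[_ iH]; rewrite exchange_big/=.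
  rewrite (bigD1_seq i) ?iota_uniq ?mem_index_iota//=.
  rewrite [X in _ + X]big_seq_cond [X in _ + X]big1 ?addr0; last first.
    move=> j /andP[]; rewrite mem_index_iota/= => jH ji.
    by rewrite sum_cos_roots// eq_sym.
  rewrite (eq_bigr (fun=> 1)); last by move=> n _; rewrite subrr cos0.
  by rewrite sumr_const_nat subn0.
by rewrite sumr_const_nat subn0 expr2 mulr_natr.
Qed.

End fejer.

Section equidistribution.
Context {R : realType}.

Definition frac (t : R) : R := t - (Num.floor t)%:~R.

Lemma frac_ge0 t : 0 <= frac t.
Proof. by rewrite subr_ge0 floor_le_tmp. Qed.

Lemma frac_lt1 t : frac t < 1.
Proof. by rewrite ltrBlDr addrC -[1]/(1%:~R) -intrD floorD1_gt. Qed.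

Lemma fracDz t (k : int) : frac (t + k%:~R) = frac t.
Proof. by rewrite /frac floorDrz ?intr_int// intrKfloor intrD; ring. Qed.

Lemma frac_id t : 0 <= t < 1 -> frac t = t.
Proof. by move=> h; rewrite /frac (floor_def (m := 0)) ?subr0// add0r. Qed.

Lemma fracE t : exists k : int, t = frac t + k%:~R.
Proof. by exists (Num.floor t); rewrite subrK. Qed.

Lemma int_ge0_or_leN1 (k : int) : (0 <= k) \/ (k <= -1).
Proof. lia. Qed.

Section arc.
Variables (H : nat) (S : seq nat) (z : nat -> R) (d : R).
Hypothesis H0 : (0 < H)%N.
Hypothesis d0 : 0 <= d.
Hypothesis hS : forall h phi, (0 < h < H)%N ->
  `|\sum_(m <- S) cos (2 * pi * (h%:R * z m) + phi)| <= d * (size S)%:R.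

(** The [H] diagonal pairs give [size S] each; every other pair is a Weyl sum of frequency
    [|i - j| < H], at most [d * size S]. *)
Lemma sum_fejer_le c :
  \sum_(m <- S) fejer H (z m - c) <= (H%:R + H%:R ^+ 2 * d) * (size S)%:R.
Proof.
set M : R := (size S)%:R.
rewrite /fejer exchange_big/=.
apply: (@le_trans _ _ (\sum_(0 <= i < H) (M + H%:R * (d * M)))); last first.
  by rewrite sumr_const_nat subn0 -mulr_natl expr2; rewrite le_eqVlt; apply/orP; left; apply/eqP; ring.
apply: ler_sum_nat => i /andP[_ iH]; rewrite exchange_big/=.
apply: (@le_trans _ _ (\sum_(0 <= j < H) ((j == i)%:R * M + d * M))); last first.
  rewrite big_split/= sumr_const_nat subn0 -[X in _ + X]mulr_natl lerD2r.
  rewrite (bigD1_seq i) ?iota_uniq ?mem_index_iota//= eqxx mul1r.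
  by rewrite big1 ?addr0// => j /negPf->; rewrite mul0r.
have dM0 : 0 <= d * M by rewrite mulr_ge0.
apply: ler_sum_nat => j /andP[_ jH]; case: (ltngtP j i) => ji.
- rewrite mul0r add0r; apply: le_trans (ler_norm _) _.
  rewrite (eq_bigr (fun m => cos (2 * pi * ((i - j)%N%:R * z m)
     + (- (2 * pi * ((i%:R - j%:R) * c)))))).
    by apply: hS; rewrite subn_gt0 ji/= (leq_ltn_trans (leq_subr _ _)).
  by move=> m _; congr cos; rewrite natrB ?(ltnW ji)//; ring.
- rewrite mul0r add0r; apply: le_trans (ler_norm _) _.
  rewrite (eq_bigr (fun m => cos (2 * pi * ((j - i)%N%:R * z m)
     + (- (2 * pi * ((j%:R - i%:R) * c)))))).
    by apply: hS; rewrite subn_gt0 ji/= (leq_ltn_trans (leq_subr _ _)).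
  by move=> m _; rewrite -cosN; congr cos; rewrite natrB ?(ltnW ji)//; ring.
- rewrite mul1r; apply: ler_wpDr => //.
  rewrite ji; under eq_bigr do rewrite subrr cos0.
  by rewrite /M -sum1_size natr_sum.
Qed.

(* The [H] shifted Fejer kernels [fejer H (t - s - n / H) / H ^ 2] sum to 1; those
   with [n / H] far from the arc are small on it. *)
Lemma arc_count_le (s l k : R) : 0 <= l -> 0 < k -> k <= 1 ->
  (count (fun m => frac (z m - s) < l) S)%:R <=
  (size S)%:R * ((l + 2 * k + 2 / H%:R) * (1 + H%:R * d) + 8 / (H%:R * k ^+ 2)).
Proof.
move=> l0 k0 k1; set M : R := (size S)%:R.
have HR : 0 < H%:R :> R by rewrite ltr0n.
(* The shifts [n / H] within [k] of the arc [[0, l)] on the circle; the second condition is the side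
   that wraps around 0. *)
pose near n := (n%:R <= (l + k) * H%:R) || ((1 - k) * H%:R <= n%:R :> R).
have cnear : (count near (iota 0 H))%:R <= (l + 2 * k) * H%:R + 2.
  pose T1 := Num.truncn ((l + k) * H%:R).
  pose T2 := Num.truncn ((1 - k) * H%:R).
  have T2H : (T2 <= H)%N.
    by rewrite -(ler_nat R) (@le_trans _ _ ((1 - k) * H%:R))// ?truncn_le; nra.
  have : (count near (iota 0 H) <= T1.+1 + (H - T2))%N.
    rewrite -size_filter -[X in (_ <= X + _)%N](size_iota 0) -[X in (_ <= _ + X)%N](size_iota T2).
    rewrite -size_cat; apply: uniq_leq_size; first by rewrite filter_uniq ?iota_uniq.
    move=> n; rewrite mem_filter mem_cat !mem_iota /= add0n => /andP[/orP[h|h] nH].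
      by rewrite ltnS truncn_ge_nat ?h// mulr_ge0// addr_ge0// ltW.
    rewrite subnKC// nH andbT; apply/orP; right.
    by rewrite -(ler_nat R) (le_trans _ h)// truncn_le mulr_ge0// subr_ge0.
  rewrite -(ler_nat R) natrD natrB// -natr1 => h; apply: (le_trans h).
  have : T1%:R <= (l + k) * H%:R by rewrite truncn_le mulr_ge0// addr_ge0// ltW.
  have : (1 - k) * H%:R < T2.+1%:R by apply: truncnS_gt.
  rewrite -natr1; nra.
pose A m := frac (z m - s) < l.
have cE : (count A S)%:R = \sum_(m <- S | A m) H%:R ^- 2 *
    \sum_(0 <= n < H) fejer H (z m - (s + n%:R / H%:R)).
  rewrite -sum1_count natr_sum; apply: eq_bigr => m _.
  under eq_bigr do rewrite opprD addrA.
  by rewrite sum_fejer_shift mulVf// gt_eqF// exprn_gt0.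
rewrite cE.
have h1 : \sum_(m <- S) \sum_(0 <= n < H | near n) fejer H (z m - (s + n%:R / H%:R)) <=
    ((l + 2 * k) * H%:R + 2) * ((H%:R + H%:R ^+ 2 * d) * M).
  rewrite exchange_big/=.
  apply: (@le_trans _ _ (\sum_(0 <= n < H | near n) ((H%:R + H%:R ^+ 2 * d) * M))).
    by apply: ler_sum => n _; exact: sum_fejer_le.
  rewrite big_const_seq iter_addr addr0 -[_ *+ count _ _]mulr_natl ler_wpM2r//.
    by rewrite mulr_ge0// addr_ge0// mulr_ge0// exprn_ge0.
  by rewrite /index_iota subn0.
(* Modulo 1, a point of the arc keeps distance at least [k] from every shift that is not near, so
   [fejer_le] applies with [r = k]. *)
have h2 m : A m -> \sum_(0 <= n < H | ~~ near n) fejer H (z m - (s + n%:R / H%:R)) <=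
    H%:R * (8 / k ^+ 2).
  move=> Am; apply: (@le_trans _ _ (\sum_(0 <= n < H) (8 / k ^+ 2))); last first.
    by rewrite sumr_const_nat subn0 -[leLHS]mulr_natl.
  rewrite big_mkcond/=; apply: ler_sum_nat => n /andP[_ nH].
  case: ifP => [|_]; last by rewrite divr_ge0// exprn_ge0// ltW.
  rewrite negb_or -!ltNge => /andP[n1 n2].
  apply: fejer_le => // j.
  have [i ei] := fracE (z m - s).
  have -> : z m - (s + n%:R / H%:R) - j%:~R = frac (z m - s) - n%:R / H%:R - (j - i)%:~R.
    by rewrite intrB opprD addrA {1}ei; ring.
  have f0 := frac_ge0 (z m - s); have fl : frac (z m - s) < l := Am.
  have {}n1 : l + k < n%:R / H%:R by rewrite ltr_pdivlMr.
  have {}n2 : n%:R / H%:R < 1 - k by rewrite ltr_pdivrMr.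
  have [q0|q0] := int_ge0_or_leN1 (j - i).
    have : 0 <= (j - i)%:~R :> R by rewrite ler0z.
    by move=> h; rewrite ler0_norm; lra.
  have : (j - i)%:~R <= (-1)%:~R :> R by rewrite ler_int.
  by rewrite mulrN1z => h; rewrite ger0_norm; lra.
apply: (@le_trans _ _ (\sum_(m <- S | A m) H%:R ^- 2 *
    (\sum_(0 <= n < H | near n) fejer H (z m - (s + n%:R / H%:R)) + H%:R * (8 / k ^+ 2)))).
  apply: ler_sum => m Am; rewrite ler_pM2l ?invr_gt0 ?exprn_gt0//.
  by rewrite (bigID near)/= lerD2l h2.
rewrite -mulr_sumr big_split/=.
apply: (@le_trans _ _ (H%:R ^- 2 * (((l + 2 * k) * H%:R + 2) * ((H%:R + H%:R ^+ 2 * d) * M)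
   + M * (H%:R * (8 / k ^+ 2))))).
  rewrite ler_pM2l ?invr_gt0 ?exprn_gt0//; apply: lerD.
    apply: le_trans h1; rewrite [leRHS](bigID A)/= lerDl.
    by apply: sumr_ge0 => m _; apply: sumr_ge0 => n _; exact: fejer_ge0.
  rewrite big_const_seq iter_addr addr0 -[_ *+ count _ _]mulr_natl ler_wpM2r//.
    by rewrite mulr_ge0// divr_ge0// exprn_ge0// ltW.
  by rewrite ler_nat count_size.
rewrite le_eqVlt; apply/orP; left; apply/eqP; field.
by rewrite gt_eqF// gt_eqF.
Qed.

End arc.
End equidistribution.

(** Here the range of [a] does not depend on [d], so the sums over [a] and over several [d] can be
    exchanged. *)
Lemma sum_smooths_dvd_filter (V : nmodType) (f : nat -> V) X y d : (lep y).-nat d ->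
  \sum_(m <- smooths X y | (d %| m)%N) f m =
  \sum_(a <- smooths X y | (a * d <= X)%N) f (d * a)%N.
Proof.
move=> sd; have d0 : (0 < d)%N by case/andP: sd.
rewrite sum_smooths_dvd// -[RHS]big_filter; apply: perm_big; apply: uniq_perm.
- exact: smooths_uniq.
- by rewrite filter_uniq ?smooths_uniq.
move=> a; rewrite [RHS]mem_filter !mem_smooths leq_divRL//.
apply/idP/idP => [/and3P[-> adX ->]|/and4P[-> -> _ ->]] //.
by rewrite adX /= andbT (leq_trans _ adX)// leq_pmulr.
Qed.

(** * The range X <= y ^ k *)

Section dense_range.
Context {R : realType}.

(** Divergence of the sum of [1 / p]: disjoint blocks of primes in intervals [(z, z ^ 6]] contribute
    at least 1/32 each. *)
Lemma primes_sum_inv_ge (B : R) : exists P : seq nat,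
  [/\ uniq P, all prime P & B <= \sum_(p <- P) p%:R^-1].
Proof.
have [z0 hz] := @sum_inv_primes_ge R.
have H n : exists P : seq nat,
    [/\ uniq P, all prime P & n%:R / 32 <= \sum_(p <- P) (p%:R : R)^-1].
  elim: n => [|n [P [uP pP hP]]]; first by exists [::]; rewrite big_nil mul0r.
  pose z := maxn z0 (\max_(p <- P) p).
  exists ([seq p <- primes_upto (z ^ 6) | (z < p)%N] ++ P); split.
  - rewrite cat_uniq uP filter_uniq ?primes_upto_uniq//= andbT.
    apply/hasPn => p ip; rewrite mem_filter negb_and -leqNgt; apply/orP; left.
    by rewrite leq_max (leq_bigmax_seq (F := id) p ip isT) ?orbT.
  - rewrite all_cat pP andbT; apply/allP => p.
    by rewrite mem_filter mem_primes_upto => /and3P[].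
  - rewrite big_cat big_filter/= -natr1 mulrDl addrC lerD// mul1r hz//.
    by rewrite leq_maxl.
have [n hn] : exists n : nat, B * 32 <= n%:R.
  by exists (Num.truncn (B * 32)).+1; rewrite ltW// truncnS_gt.
have [P [uP pP hP]] := H n; exists P; split => //.
by apply: le_trans hP; rewrite ler_pdivlMr.
Qed.

Lemma sum_dvd_iota X d : (0 < d)%N ->
  \sum_(m <- iota 1 X) (d %| m)%:R = (X %/ d)%:R :> R.
Proof.
move=> d0; have sd : (lep (maxn X d)).-nat d.
  by apply/pnatP => // p pp pd; rewrite inE leq_max (dvdn_leq d0 pd) orbT.
rewrite -(@smooths_all X (maxn X d)) ?leq_maxl//.
under eq_bigr => m _ do rewrite mulrb.
rewrite -big_mkcond/= (sum_smooths_dvd (fun=> 1 : R))// smooths_all.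
  by rewrite big_const_seq count_predT size_iota iter_addr addr0.
by rewrite (leq_trans (leq_div _ _))// leq_maxl.
Qed.

Lemma natr_divn_gt X d : (0 < d)%N -> X%:R / d%:R - 1 <= (X %/ d)%:R :> R.
Proof.
move=> d0; rewrite lerBlDr natr1 ler_pdivrMr ?ltr0n// -natrM ler_nat ltnW//.
exact: ltn_ceil.
Qed.

(** When the square is expanded, the main terms [X / (p q)] of a pair [p != q] cancel up to rounding
    errors of at most [1 / p + 1 / q <= 2]; the diagonal gives the first term. The error is harmless
    because [P] stays fixed while [X] grows. *)
Lemma turan_kubilius (P : seq nat) X : uniq P -> all prime P ->
  \sum_(m <- iota 1 X) (\sum_(p <- P) ((p %| m)%:R - p%:R^-1)) ^+ 2 <=
  X%:R * \sum_(p <- P) p%:R^-1 + 2 * (size P)%:R ^+ 2 :> R.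
Proof.
move=> uP pP.
have -> : \sum_(m <- iota 1 X) (\sum_(p <- P) ((p %| m)%:R - (p%:R : R)^-1)) ^+ 2 =
  \sum_(p <- P) \sum_(q <- P) \sum_(m <- iota 1 X)
     ((p %| m)%:R - p%:R^-1) * ((q %| m)%:R - q%:R^-1).
  under eq_bigr => m _.
    rewrite expr2 mulr_suml.
    under eq_bigr => p _ do rewrite mulr_sumr.
    over.
  rewrite exchange_big/=; apply: eq_bigr => p _.
  by rewrite exchange_big.
apply: (@le_trans _ _ (\sum_(p <- P) \sum_(q <- P) ((p == q)%:R * (X%:R / p%:R) + 2))); last first.
  rewrite mulr_sumr -sum1_size natr_sum expr2 mulr_suml mulr_sumr -big_split/=.
  rewrite big_seq [leRHS]big_seq; apply: ler_sum => p ip.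
  rewrite big_split/= (bigD1_seq p)//= eqxx mul1r big1 ?addr0; last first.
    by move=> q qp; rewrite eq_sym (negPf qp) mul0r.
  by rewrite lerD2l mul1r mulr_sumr; apply: ler_sum => q _; rewrite mulr1.
rewrite big_seq [leRHS]big_seq; apply: ler_sum => p ip.
rewrite big_seq [leRHS]big_seq; apply: ler_sum => q iq.
have pp := allP pP _ ip; have qq := allP pP _ iq.
have p0 := prime_gt0 pp; have q0 := prime_gt0 qq.
have pR : 1 <= p%:R :> R by rewrite ler1n.
have qR : 1 <= q%:R :> R by rewrite ler1n.
pose u : R := p%:R^-1; pose v : R := q%:R^-1.
have u01 : 0 < u <= 1 by rewrite invr_gt0 ltr0n p0/= invf_le1// (lt_le_trans ltr01).
have v01 : 0 < v <= 1 by rewrite invr_gt0 ltr0n q0/= invf_le1// (lt_le_trans ltr01).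
have -> : \sum_(m <- iota 1 X) ((p %| m)%:R - u) * ((q %| m)%:R - v) =
   \sum_(m <- iota 1 X) ((p %| m)%N && (q %| m)%N)%:R - v * (X %/ p)%:R
    - u * (X %/ q)%:R + X%:R * u * v.
  rewrite -!sum_dvd_iota// -[in X%:R](size_iota 1 X) -sum1_size natr_sum.
  rewrite !mulr_sumr !mulr_suml -!sumrB -big_split/=; apply: eq_bigr => m _.
  by rewrite -mulnb natrM; ring.
have hp := natr_divn_gt X p0; have hq := natr_divn_gt X q0.
rewrite -/u -/v in hp hq *.
have X0 : 0 <= X%:R :> R by [].
set xp := (X %/ p)%:R in hp *; set xq := (X %/ q)%:R in hq *.
have {}hp : v * (X%:R * u - 1) <= v * xp by rewrite ler_wpM2l//; lra.
have {}hq : u * (X%:R * v - 1) <= u * xq by rewrite ler_wpM2l//; lra.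
case: (eqVneq p q) => pq.
  subst q; under eq_bigr do rewrite andbb.
  rewrite sum_dvd_iota// -/xp mul1r.
  have : xp <= X%:R * u by apply: natr_divn_le.
  rewrite -/v in v01 hp hq *; rewrite (_ : v = u)// in hp hq *.
  have : 0 <= X%:R * u * u by rewrite !mulr_ge0//; lra.
  lra.
rewrite mul0r add0r.
have -> : \sum_(m <- iota 1 X) ((p %| m)%N && (q %| m)%N)%:R = (X %/ (p * q))%:R :> R.
  rewrite -sum_dvd_iota ?muln_gt0 ?p0//; apply: eq_bigr => m _.
  by rewrite Gauss_dvd// prime_coprime// dvdn_prime2.
have : (X %/ (p * q))%:R <= X%:R * u * v :> R.
  by apply: (le_trans (natr_divn_le _ _)); rewrite natrM invfM mulrA.
lra.
Qed.

(** Arithmetic-geometric mean with a free parameter: a linear substitute for Cauchy-Schwarz that can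
    be summed term by term. *)
Lemma le_norm_sqr_mean (u xi : R) : 0 < xi -> `|u| <= (u ^+ 2 / xi + xi) / 2.
Proof.
move=> x0; rewrite ler_pdivlMr// -(ler_pM2r x0) mulrDl divfK ?gt_eqF//.
by rewrite -(real_normK (num_real u)); have := sqr_ge0 (`|u| - xi); nra.
Qed.

Lemma sum_norm_le_mean (s : seq nat) (u : nat -> R) X xi : 0 < xi -> uniq s ->
  {subset s <= iota 1 X} ->
  `|\sum_(m <- s) u m| <= ((\sum_(m <- iota 1 X) u m ^+ 2) / xi + X%:R * xi) / 2.
Proof.
move=> x0 us sX; apply: (le_trans (ler_norm_sum _ _ _)).
apply: (@le_trans _ _ (\sum_(m <- s) (u m ^+ 2 / xi + xi) / 2)).
  by apply: ler_sum => m _; exact: le_norm_sqr_mean.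
apply: (@le_trans _ _ (\sum_(m <- iota 1 X) (u m ^+ 2 / xi + xi) / 2)).
  rewrite [leRHS](bigID (mem s))/=.
  rewrite -[X in _ <= X + _]big_filter.
  rewrite (perm_big [seq m <- iota 1 X | m \in s]) /=; last first.
    apply: uniq_perm => //; first by rewrite filter_uniq ?iota_uniq.
    move=> m; rewrite mem_filter; case: (boolP (m \in s)) => //= ms.
    by rewrite sX.
  rewrite lerDl; apply: sumr_ge0 => m _.
  by rewrite divr_ge0// addr_ge0 ?(ltW x0)// divr_ge0 ?sqr_ge0// ltW.
rewrite -mulr_suml big_split/= -mulr_suml big_const_seq count_predT size_iota.
by rewrite iter_addr addr0 -[xi *+ X]mulr_natl.
Qed.

Lemma min_frac_le (t : R) (k : int) : Num.min (frac t) (1 - frac t) <= `|t - k%:~R|.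
Proof.
have [i ei] := fracE t; have f0 := frac_ge0 t; have f1 := frac_lt1 t.
rewrite {3}ei (_ : frac t + i%:~R - k%:~R = frac t - (k - i)%:~R); last first.
  by rewrite intrB; ring.
have [q0|q0] : (1 <= k - i) \/ (k - i <= 0) by lia.
  have : 1%:~R <= (k - i)%:~R :> R by rewrite ler_int.
  by move=> h; rewrite ge_min ler0_norm; [apply/orP; right; lra|lra].
have : (k - i)%:~R <= 0%:~R :> R by rewrite ler_int.
by move=> h; rewrite ge_min ger0_norm; [apply/orP; left; lra|lra].
Qed.

Lemma irrational_gap (t : R) : (forall k : int, t != k%:~R) ->
  exists2 r, 0 < r & forall k : int, r <= `|t - k%:~R|.
Proof.
move=> ht; have [i ei] := fracE t; have f1 := frac_lt1 t.
have fn : 0 < frac t.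
  rewrite lt_neqAle frac_ge0 andbT; apply: contraNN (ht i) => /eqP e.
  by rewrite {1}ei -e add0r.
exists (Num.min (frac t) (1 - frac t)); first by rewrite lt_min fn/= subr_gt0.
exact: min_frac_le.
Qed.

Lemma irrational_gap_seq (T : eqType) (s : seq T) (t : T -> R) :
  (forall i, i \in s -> forall k : int, t i != k%:~R) ->
  exists2 r, 0 < r & forall i, i \in s -> forall k : int, r <= `|t i - k%:~R|.
Proof.
elim: s => [|i s IH] h; first by exists 1.
have [r r0 hr] := IH (fun j js => h j (mem_behead (s := i :: s) js)).
have [r' r'0 hr'] := irrational_gap (h i (mem_head _ _)).
exists (Num.min r r'); first by rewrite lt_min r0.
move=> j; rewrite inE => /orP[/eqP->|js] k; rewrite ge_min ?hr' ?orbT//.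
by rewrite hr.
Qed.

(* Katai's argument: weight the sum by the number of prime factors in a fixed set
   [P], nearly constant by Turan-Kubilius when the sum of [1/p] over [P] is
   large, then apply Cauchy-Schwarz to the resulting sums over [p * a]. *)
Lemma dense_cos_sum (beta : R) k (d : R) : 0 < d ->
  (forall n : nat, (0 < n)%N -> forall j : int, n%:R * beta != j%:~R) ->
  exists X0 : nat, forall X y, (X0 <= X)%N -> (X <= y ^ k)%N -> forall phi,
  `|\sum_(m <- smooths X y) cos (2 * pi * (m%:R * beta) + phi)| <= d * X%:R.
Proof.
move=> d0 irr.
(* With [xi = 4 / d], each of the terms [X L / xi], [X xi] and [C / xi] of [hT] is at most
   [(d / 4) X L]: the second because [L >= 16 / d ^ 2], the third because [X L >= C]. *)
have [P [uP pP hL]] := primes_sum_inv_ge (16 / d ^+ 2).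
set L := \sum_(p <- P) _ in hL; pose xi := 4 / d.
have xi0 : 0 < xi by rewrite divr_gt0.
have L0 : 0 < L by apply: lt_le_trans hL; rewrite divr_gt0// exprn_gt0.
have [r r0 hr] : exists2 r : R, 0 < r & forall p q, p \in P -> q \in P -> p != q ->
    forall j : int, r <= `|(p%:R - q%:R) * beta - j%:~R|.
  have := @irrational_gap_seq _ [seq u <- [seq (p, q) | p <- P, q <- P] | u.1 != u.2]
     (fun u => (u.1%:R - u.2%:R) * beta).
  case=> [[p q]|r r0 hr].
    rewrite mem_filter /= => /andP[pq _] j; case: (ltngtP p q) pq => // lt _.
      apply/eqP => e; have := irr (q - p)%N ltac:(by rewrite subn_gt0) (- j).
      by rewrite natrB ?(ltnW lt)// mulrNz -e -mulNr opprB eqxx.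
    by have := irr (p - q)%N ltac:(by rewrite subn_gt0) j; rewrite natrB ?(ltnW lt).
  exists r => // p q ip iq pq j; apply: (hr (p, q)).
  by rewrite mem_filter /= pq; apply: allpairs_f.
pose C : R := 2 * (size P)%:R ^+ 2 + (size P)%:R ^+ 2 * (2 / r).
pose B := \max_(p <- P) p.
exists (maxn (Num.truncn (C / L)).+1 (B ^ k).+1) => X y.
rewrite geq_max => /andP[XC XB] Xy phi.
have By : (B <= y)%N.
  rewrite leqNgt; apply/negP => yB; move: XB; rewrite ltnNge (leq_trans Xy)//.
  by case: (k) => // k'; rewrite leq_exp2r// ltnW.
have Py p : p \in P -> (lep y).-nat p.
  move=> ip; rewrite lep_prime ?(allP pP)// (leq_trans _ By)//.
  exact: (leq_bigmax_seq (F := id) p ip isT).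
pose f m : R := cos (2 * pi * (m%:R * beta) + phi).
rewrite -/(f _); set T := \sum_(m <- _) _.
pose g a : R := \sum_(p <- P | (a * p <= X)%N) f (p * a)%N.
pose w m : R := \sum_(p <- P) ((p %| m)%:R - p%:R^-1).
(* Each [f m] is taken once for every [p] in [P] dividing [m], and the number of these is
   [L + w m]. *)
have e1 : \sum_(m <- smooths X y) g m = L * T + \sum_(m <- smooths X y) w m * f m.
  rewrite /g (exchange_big_dep xpredT)//=.
  transitivity (\sum_(p <- P) \sum_(m <- smooths X y) (p %| m)%:R * f m).
    rewrite big_seq [RHS]big_seq; apply: eq_bigr => p ip.
    rewrite -sum_smooths_dvd_filter ?Py// big_mkcond; apply: eq_bigr => m _.
    by case: (p %| m)%N; rewrite ?mul1r ?mul0r.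
  rewrite exchange_big/= /T mulr_sumr -big_split/=; apply: eq_bigr => m _.
  by rewrite /w sumrB -/L mulrBl -mulr_suml addrC subrK.
have sX : {subset smooths X y <= iota 1 X}.
  by move=> m; rewrite mem_smooths mem_iota add1n ltnS => /and3P[-> ->].
have bw : `|\sum_(m <- smooths X y) w m * f m| <=
    ((X%:R * L + 2 * (size P)%:R ^+ 2) / xi + X%:R * xi) / 2.
  apply: (le_trans (sum_norm_le_mean _ xi0 (smooths_uniq X y) sX)).
  rewrite ler_pM2r// lerD2r ler_pM2r ?invr_gt0//.
  apply: le_trans (turan_kubilius X uP pP); apply: ler_sum => m _.
  rewrite exprMn -[leRHS]mulr1 ler_wpM2l ?sqr_ge0//.
  by rewrite -real_normK ?num_real// expr_le1// cos_max.
(* Smoothness of [a] is given up: the squares are summed over all [a <= X], and for [p != q] the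
   inner sum over [a] becomes geometric. *)
have bg : `|\sum_(m <- smooths X y) g m| <=
    ((X%:R * L + (size P)%:R ^+ 2 * (2 / r)) / xi + X%:R * xi) / 2.
  apply: (le_trans (sum_norm_le_mean _ xi0 (smooths_uniq X y) sX)).
  rewrite ler_pM2r// lerD2r ler_pM2r ?invr_gt0//.
  apply: (@le_trans _ _ (\sum_(a <- iota 1 X) \sum_(p <- P | (a * p <= X)%N)
      \sum_(q <- P | (a * q <= X)%N) cos (2 * pi * ((p * a)%:R * beta) - 2 * pi * ((q * a)%:R * beta)))).
    apply: ler_sum => a _; rewrite /g -big_filter -[leRHS]big_filter.
    under [leRHS]eq_bigr => p _ do rewrite -big_filter.
    exact: (sqr_sum_cos_le _ (fun p => 2 * pi * ((p * a)%:R * beta)) phi).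
  rewrite (exchange_big_dep xpredT)//=.
  under eq_bigr => p _ do rewrite (exchange_big_dep xpredT)//=.
  apply: (@le_trans _ _ (\sum_(p <- P) \sum_(q <- P) ((p == q)%:R * (X%:R / p%:R) + 2 / r))); last first.
    rewrite mulr_sumr -sum1_size natr_sum expr2 mulr_suml mulr_suml -big_split/=.
    rewrite big_seq [leRHS]big_seq; apply: ler_sum => p ip.
    rewrite big_split/= (bigD1_seq p)//= eqxx mul1r big1 ?addr0; last first.
      by move=> q qp; rewrite eq_sym (negPf qp) mul0r.
    by rewrite lerD2l mul1r mulr_suml; apply: ler_sum => q _; rewrite mul1r.
  rewrite big_seq [leRHS]big_seq; apply: ler_sum => p ip.
  rewrite big_seq [leRHS]big_seq; apply: ler_sum => q iq.
  have p0 := prime_gt0 (allP pP _ ip); have q0 := prime_gt0 (allP pP _ iq).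
  have -> : \sum_(a <- iota 1 X | (a * p <= X)%N && (a * q <= X)%N)
      cos (2 * pi * ((p * a)%:R * beta) - 2 * pi * ((q * a)%:R * beta)) =
      \sum_(1 <= a < (X %/ maxn p q).+1) cos (2 * pi * (a%:R * ((p%:R - q%:R) * beta)) + 0).
    have -> : iota 1 X = index_iota 1 X.+1 by rewrite /index_iota subSS subn0.
    rewrite [RHS](big_nat_widen 1 _ X.+1) ?ltnS ?leq_div//.
    apply: eq_big => [a|a _] /=.
      by rewrite ltnS leq_divRL ?leq_max ?p0// maxnMr geq_max.
    by rewrite !natrM; congr cos; ring.
  case: (eqVneq p q) => pq.
    rewrite pq maxnn subrr mul0r mul1r.
    apply: (@le_trans _ _ (\sum_(1 <= a < (X %/ q).+1) 1)).
      by apply: ler_sum => a _; exact: cos_le1.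
    rewrite sumr_const_nat subSS subn0 -[leLHS]/((X %/ q)%:R).
    by rewrite (le_trans (natr_divn_le _ _))// lerDl divr_ge0// ltW.
  rewrite mul0r add0r; apply: (le_trans (ler_norm _)).
  by apply: norm_sum_cos_le => // j; exact: hr.
have hT : L * `|T| <= X%:R * L / xi + X%:R * xi + C / xi.
  rewrite -[X in X * _](gtr0_norm L0) -normrM.
  have -> : L * T = \sum_(m <- smooths X y) g m - \sum_(m <- smooths X y) w m * f m.
    by rewrite e1 addrK.
  apply: (le_trans (ler_normB _ _)); apply: (le_trans (lerD bg bw)).
  have C0 : 0 <= C.
    have s0 : 0 <= (size P)%:R ^+ 2 :> R by rewrite exprn_ge0.
    have r2 : 0 <= 2 / r by rewrite divr_ge0// ltW.
    by rewrite addr_ge0// mulr_ge0.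
  have : 0 <= C / xi by rewrite divr_ge0// ltW.
  rewrite /C !mulrDl; set u := _ / xi; lra.
have XC' : C <= X%:R * L.
  rewrite -ler_pdivrMr//; apply: ltW; apply: (lt_le_trans (truncnS_gt _)).
  by rewrite ler_nat.
rewrite -(ler_pM2l L0); apply: (le_trans hT).
have hxi : xi^-1 = d / 4 by rewrite /xi; field; rewrite gt_eqF.
have : X%:R * xi <= d / 4 * (X%:R * L).
  rewrite [leRHS]mulrCA ler_wpM2l// (_ : xi = d / 4 * (16 / d ^+ 2)).
    by rewrite ler_wpM2l// divr_ge0// ltW.
  by rewrite /xi; field; rewrite gt_eqF.
have : C * (d / 4) <= X%:R * L * (d / 4) by rewrite ler_pM2r// divr_gt0.
have : 0 <= d * (X%:R * L) by rewrite !mulr_ge0// ltW.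
rewrite hxi; lra.
Qed.

End dense_range.

(** * The range y ^ k < X *)

Definition gep (p : nat) : nat_pred := [pred q | (p <= q)%N].

(* [c] is the product of the least prime factors of [m], taken in increasing
   order with multiplicity until the product reaches [N]; [p] is the last one. *)
Definition least_part (N p c m : nat) : bool :=
  [&& (N <= c)%N, (p %| c)%N, (lep p).-nat c, (c %/ p < N)%N, (c %| m)%N
    & (gep p).-nat (m %/ c)%N].

Lemma least_part_ex N y m : (1 < N)%N -> (N <= m)%N -> (lep y).-nat m ->
  exists p c, [/\ prime p, (p <= y)%N & least_part N p c m].
Proof.
move=> N1 Nm sm; have m0 : (0 < m)%N by case/andP: sm.
(* Invariant: [m = a b] with [b < N] and no prime of [b] above a prime of [a]. The least prime of
   [a] is moved to [b] until the product reaches [N]. *)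
suff H n : forall a b, (a <= n)%N -> (a * b)%N = m -> (b < N)%N ->
    (forall q r, prime q -> (q %| b)%N -> prime r -> (r %| a)%N -> (q <= r)%N) ->
    exists p c, [/\ prime p, (p <= y)%N & least_part N p c m].
  apply: (H m m 1%N) => //; rewrite ?muln1// => q r pq.
  by rewrite dvdn1 => /eqP q1; rewrite q1 in pq.
elim: n => [|n IH] a b an abm bN rough.
  by move: an m0; rewrite leqn0 => /eqP a0; rewrite -abm a0.
have a1 : (1 < a)%N.
  rewrite ltnNge; apply/negP => a1; move: Nm; rewrite -abm leqNgt.
  by rewrite (leq_ltn_trans _ bN)// -[leqRHS]mul1n leq_mul2r a1 orbT.
have pp := pdiv_prime a1; have pa := pdiv_dvd a; set p := pdiv a in pp pa *.
have p0 := prime_gt0 pp.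
have [a2 ea] := dvdnP pa.
have b0 : (0 < b)%N by move: m0; rewrite -abm muln_gt0 => /andP[].
have a20 : (0 < a2)%N by move: m0; rewrite -abm ea !muln_gt0 => /andP[/andP[]].
have py : (p <= y)%N.
  by move/pnatP: sm => /(_ m0 p pp); apply; rewrite -abm dvdn_mulr.
case: (leqP N (b * p)) => Nbp.
  exists p, (b * p)%N; split => //; rewrite /least_part Nbp dvdn_mull// mulnK//.
  rewrite bN -abm ea -mulnA [(p * b)%N]mulnC dvdn_mull// mulnK ?muln_gt0 ?b0//=.
  apply/andP; split; apply/pnatP => //.
  - by rewrite muln_gt0 b0.
  - move=> q qq; rewrite Euclid_dvdM// => /orP[qb|]; rewrite inE.
      exact: (rough q p).
    by rewrite dvdn_prime2// => /eqP->.
  - by move=> q qq qa; rewrite inE pdiv_min_dvd ?prime_gt1// ea dvdn_mulr.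
apply: (IH a2 (b * p)%N) => //.
- rewrite -ltnS (leq_trans _ an)// ea -[X in (X < _)%N]muln1 ltn_mul2l a20.
  exact: prime_gt1.
- by rewrite -abm ea; lia.
- move=> q r qq; rewrite Euclid_dvdM// => /orP[qb|qp] rr ra.
    by apply: (rough q r) => //; rewrite ea dvdn_mulr.
  move: qp; rewrite dvdn_prime2// => /eqP->.
  by rewrite pdiv_min_dvd ?prime_gt1// ea dvdn_mulr.
Qed.

(** If [p < p'], all primes of [c] lie below those of [p' * (m / c')], so [c] divides [c' / p']; but
    [c' / p' < N <= c]. *)
Lemma least_part_lt N p c p' c' m : (0 < m)%N -> prime p -> prime p' ->
  least_part N p c m -> least_part N p' c' m -> ~~ (p < p')%N.
Proof.
move=> m0 pp pp' /and5P[Nc pc sc cN /andP[cm ra]] /and5P[Nc' pc' sc' cN' /andP[cm' ra']].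
apply/negP => lt.
have c'0 : (0 < c')%N by apply: dvdn_gt0 cm'.
have [b eb] := dvdnP pc'; have p'0 := prime_gt0 pp'.
have b0 : (0 < b)%N by move: c'0; rewrite eb muln_gt0 => /andP[].
have em : m = (b * (p' * (m %/ c')))%N by rewrite mulnA -eb mulnC divnK.
have cop : coprime c (p' * (m %/ c')).
  apply: (@pnat_coprime (lep p)) => //.
  apply/pnatP; first by rewrite muln_gt0 p'0 divn_gt0 ?(dvdn_leq m0).
  move=> q qq; rewrite Euclid_dvdM// !inE -ltnNge => /orP[|qa].
    by rewrite dvdn_prime2// => /eqP->.
  move/pnatP: ra' => /(_ _ q qq qa); rewrite inE => h; apply: (leq_trans lt).
  by apply: h; rewrite divn_gt0 ?(dvdn_leq m0).
have : (c %| b)%N by rewrite -(Gauss_dvdl _ cop) -em.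
move=> /(dvdn_leq b0) cb; move: cN'; rewrite eb mulnK// ltnNge.
by rewrite (leq_trans Nc).
Qed.

(** All of [m] at primes below [p] is contained in [c], so only the exponent of [p] is free. If two
    exponents were possible, the larger [c] divided by [p] would still be a multiple of the smaller
    one, hence at least [N]. *)
Lemma least_part_eq N p c c' m : (0 < m)%N -> prime p ->
  least_part N p c m -> least_part N p c' m -> c = c'.
Proof.
move=> m0 pp.
suff H d d' : least_part N p d m -> least_part N p d' m ->
    (logn p d' <= logn p d)%N -> d = d' \/ (logn p d' < logn p d)%N /\ False.
  move=> h h'; case: (leqP (logn p c') (logn p c)) => hl.
    by case: (H c c' h h' hl) => // [[]].
  by case: (H c' c h' h (ltnW hl)) => // [[]].
move=> /and5P[Nc pc sc cN /andP[cm ra]] /and5P[Nc' pc' sc' cN' /andP[cm' ra']] hl.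
have d0 : (0 < d)%N by apply: dvdn_gt0 cm.
have d'0 : (0 < d')%N by apply: dvdn_gt0 cm'.
pose pi : nat_pred := [pred q | (q < p)%N].
have part e : (0 < e)%N -> (e %| m)%N -> (gep p).-nat (m %/ e)%N -> (m`_pi = e`_pi)%N.
  move=> e0 em re; have q0 : (0 < m %/ e)%N by rewrite divn_gt0 ?(dvdn_leq m0).
  rewrite -{1}(divnK em) partnM// (_ : ((m %/ e)`_pi)%N = 1%N) ?mul1n//.
  apply: part_p'nat; apply/pnatP => // q qq qa; rewrite !inE -leqNgt.
  by move/pnatP: re => /(_ q0 q qq qa).
have split e : (0 < e)%N -> (lep p).-nat e -> e = (e`_pi * p ^ logn p e)%N.
  move=> e0 se; rewrite -p_part -{1}(partnC pi e0); congr (_ * _)%N.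
  apply: eq_in_partn => q; rewrite mem_primes => /and3P[qq _ qe]; rewrite !inE.
  move/pnatP: se => /(_ e0 q qq qe); rewrite inE => qp.
  by rewrite -leqNgt eqn_leq qp.
have e1 := split d d0 sc; have e2 := split d' d'0 sc'.
rewrite -part// (part d')// in e1.
case: (ltngtP (logn p d') (logn p d)) hl => // [lt _|e _].
  right; split => //; move: cN; rewrite ltnNge => /negP; apply.
  apply: (leq_trans Nc'); apply: dvdn_leq; first by rewrite divn_gt0 ?prime_gt0 ?(dvdn_leq d0).
  rewrite dvdn_divRL// [X in (X * _ %| _)%N]e2 [X in (_ %| X)%N]e1 -mulnA -expnSr dvdn_pmul2l ?part_gt0// dvdn_exp2l//.
by left; rewrite e1 [RHS]e2 e.
Qed.

Lemma big_unique (V : nmodType) (I : eqType) (s : seq I) (P : pred I) (i : I) (x : V) :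
  uniq s -> i \in s -> P i -> (forall j, P j -> j = i) -> \sum_(j <- s | P j) x = x.
Proof.
move=> us is_ Pi un; rewrite big_mkcond (bigD1_seq i)//= Pi big1 ?addr0// => j ji.
by case: ifP => // /un e; rewrite e eqxx in ji.
Qed.

(** Each [m > M] satisfies [m >= N], so it has exactly one pair [(p, c)]; the bound [c < N y] comes
    from [c / p < N] and [p <= y]. *)
Lemma sum_smooths_least_part (V : nmodType) (f : nat -> V) X y N M :
  (1 < N)%N -> (N <= M.+1)%N ->
  \sum_(m <- smooths X y | (M < m)%N) f m =
  \sum_(p <- primes_upto y)
    \sum_(c <- index_iota N (N * y) | [&& (p %| c)%N, (lep p).-nat c & (c %/ p < N)%N])
      \sum_(a <- smooths (X %/ c) y | (M < c * a)%N && (gep p).-nat a) f (c * a)%N.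
Proof.
move=> N1 NM.
transitivity (\sum_(m <- smooths X y | (M < m)%N)
   \sum_(u <- [seq (p, c) | p <- primes_upto y, c <- index_iota N (N * y)] |
      prime u.1 && least_part N u.1 u.2 m) f m).
  rewrite big_seq_cond [RHS]big_seq_cond; apply: eq_bigr => m /andP[].
  rewrite mem_smooths => /and3P[m0 mX sm] Mm.
  have [p [c [pp py lp]]] := least_part_ex N1 (leq_trans NM Mm) sm.
  rewrite (@big_unique _ _ _ _ (p, c))//.
  - rewrite allpairs_uniq ?primes_upto_uniq ?iota_uniq//.
    by move=> [a b] [a' b'] _ _ [-> ->].
  - apply: allpairs_f; first by rewrite mem_primes_upto pp.
    case/and5P: lp => Nc pc _ cN _; rewrite mem_index_iota Nc /=.
    rewrite -(divnK pc) (@leq_trans (N * p))//; last by rewrite leq_mul2l py orbT.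
    by rewrite ltn_mul2r prime_gt0.
  - by rewrite pp.
  - move=> [p' c'] /= /andP[pp' lp'].
    have := least_part_lt m0 pp pp' lp lp'; have := least_part_lt m0 pp' pp lp' lp.
    case: ltngtP => // e _ _; subst p'.
    by rewrite (least_part_eq m0 pp lp lp').
under eq_bigr => m _ do rewrite big_mkcond big_allpairs_dep/=.
rewrite exchange_big/= big_seq [RHS]big_seq; apply: eq_bigr => p.
rewrite mem_primes_upto => /andP[pp py].
rewrite exchange_big/= big_seq [RHS]big_seq_cond [RHS]big_mkcondr/=.
apply: eq_bigr => c; rewrite mem_index_iota => /andP[Nc cNy].
case: ifP => [/and3P[pc sc cN]|h]; last first.
  apply: big1 => m _; rewrite pp /= /least_part; case: ifP => // /and5P[_ h1 h2 h3 /andP[_ _]].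
  by rewrite h1 h2 h3 in h.
have sy : (lep y).-nat c.
  apply: sub_in_pnat sc => q _; rewrite !inE => qp; exact: leq_trans py.
have c0 : (0 < c)%N by case/andP: sc.
pose g m := if (M < m)%N && (gep p).-nat (m %/ c)%N then f m else 0.
transitivity (\sum_(m <- smooths X y | (c %| m)%N) g m).
  rewrite big_mkcond [RHS]big_mkcond; apply: eq_bigr => m _.
  rewrite pp /least_part Nc pc sc cN /g /=.
  by case: (M < m)%N => /=; case: (c %| m)%N.
rewrite (sum_smooths_dvd g)// [RHS]big_mkcond; apply: eq_bigr => a _.
by rewrite /g mulKn.
Qed.

(** * Cauchy-Schwarz for the bilinear sum *)

Section bilinear.
Context {R : realType}.

Lemma big_nat_between (F : nat -> R) N L u v :
  \sum_(N <= c < L | (u <= c < v)%N) F c = \sum_(maxn N u <= c < minn L v) F c.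
Proof.
rewrite -big_filter; apply: perm_big; apply: uniq_perm.
- by rewrite filter_uniq ?iota_uniq.
- exact: iota_uniq.
by move=> c; rewrite mem_filter !mem_index_iota; lia.
Qed.

(* For a fixed largest prime [p] of the least part [c], the cofactor [a] does not
   depend on [c] except through [M < c * a <= X], so the square over [c] can be
   opened and the sum over [c] evaluated first. *)
Lemma bilinear_cos_sum (beta phi : R) X y N M (K : nat -> nat -> R) (W xi : R) :
  (1 < N)%N -> (N <= M.+1)%N -> 0 < xi ->
  let A := [seq a <- smooths (X %/ N) y | (M < a * (N * y))%N] in
  (forall a a' u v, a \in A -> a' \in A -> (v - u <= N * y)%N ->
    \sum_(u <= c < v) cos (2 * pi * (c%:R * ((a%:R - a'%:R) * beta)) + 0) <= K a a') ->
  (forall a, a \in A -> \sum_(a' <- A) K a a' <= W) ->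
  `|\sum_(m <- smooths X y | (M < m)%N) cos (2 * pi * (m%:R * beta) + phi)| <=
    y%:R * (((size A)%:R * W / xi + (N * y)%:R * xi) / 2).
Proof.
move=> N1 NM xi0 A hK hW.
rewrite (sum_smooths_least_part (fun m => cos (2 * pi * (m%:R * beta) + phi)) X y N1 NM).
apply: (le_trans (ler_norm_sum _ _ _)).
set B := (_ / 2).
(* An empty range of summation in [hK] already forces [K] to be nonnegative. *)
have K0 a a' : a \in A -> a' \in A -> 0 <= K a a'.
  by move=> ia ia'; have := hK a a' 0%N 0%N ia ia' isT; rewrite big_geq.
have N0 : (0 < N)%N by apply: ltnW.
have B0 : 0 <= B.
  rewrite divr_ge0// addr_ge0//; last by rewrite mulr_ge0// ltW.
  rewrite divr_ge0 ?(ltW xi0)//; case EA : (A) => [|a A']; first by rewrite mul0r.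
  rewrite mulr_ge0//.
  have ia : a \in A by rewrite EA mem_head.
  apply: le_trans (hW a ia); rewrite big_seq; apply: sumr_ge0 => a' ia'; exact: K0.
have sy : (size (primes_upto y) <= y)%N.
  rewrite -[leqRHS](size_iota 1); apply: uniq_leq_size; first exact: primes_upto_uniq.
  by move=> p; rewrite mem_primes_upto mem_iota add1n ltnS => /andP[/prime_gt0->].
apply: (@le_trans _ _ (\sum_(p <- primes_upto y) B)); last first.
  rewrite big_const_seq count_predT iter_addr addr0 -[B *+ _]mulr_natl.
  by rewrite ler_wpM2r// ler_nat.
apply: ler_sum => p _.
apply: (le_trans (ler_norm_sum _ _ _)).
pose Q c a := [&& (gep p).-nat a, (M < c * a)%N & (c * a <= X)%N].
pose g c a : R := 2 * pi * ((c * a)%:R * beta).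
pose u c := \sum_(a <- A | Q c a) cos (g c a + phi).
apply: (@le_trans _ _ (\sum_(N <= c < N * y) (u c ^+ 2 / xi + xi) / 2)).
  rewrite big_mkcond/=; apply: ler_sum_nat => c /andP[Nc cNy].
  case: ifP => _; last by rewrite divr_ge0// addr_ge0 ?(ltW xi0)// divr_ge0 ?sqr_ge0// ltW.
  have c0 : (0 < c)%N by apply: leq_trans Nc.
  have -> : \sum_(a <- smooths (X %/ c) y | (M < c * a)%N && (gep p).-nat a)
      cos (2 * pi * ((c * a)%:R * beta) + phi) = u c.
    rewrite /u -[LHS]big_filter -[RHS]big_filter; apply: perm_big; apply: uniq_perm.
    - by rewrite filter_uniq ?smooths_uniq.
    - by rewrite !filter_uniq ?iota_uniq.
    move=> a; rewrite mem_filter [RHS]mem_filter /Q mem_smooths [a \in A]mem_filter mem_smooths.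
    rewrite !leq_divRL// [(c * a)%N]mulnC.
    case: ((gep p).-nat a); rewrite ?andbF//= ?andbT.
    case: (ltnP M (a * c)) => //= Mac.
    case: (leqP (a * c) X) => acX; rewrite ?andbF//=.
    have -> : (M < a * (N * y))%N.
      by apply: (leq_trans Mac); rewrite leq_mul2l ltnW ?orbT.
    by rewrite (leq_trans _ acX) ?leq_mul2l ?Nc ?orbT.
  exact: le_norm_sqr_mean.
rewrite -mulr_suml /B ler_pM2r// big_split/= -mulr_suml; apply: lerD; last first.
  rewrite sumr_const_nat -[leLHS]mulr_natl ler_wpM2r ?(ltW xi0)//.
  by rewrite ler_nat leq_subr.
rewrite ler_pM2r ?invr_gt0//.
apply: (@le_trans _ _ (\sum_(N <= c < N * y) \sum_(a <- A | Q c a) \sum_(a' <- A | Q c a')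
    cos (g c a - g c a'))).
  apply: ler_sum => c _; rewrite /u -big_filter -[leRHS]big_filter.
  under [leRHS]eq_bigr => a _ do rewrite -big_filter.
  exact: sqr_sum_cos_le.
rewrite (exchange_big_dep xpredT)//=.
under eq_bigr => a _ do rewrite (exchange_big_dep xpredT)//=.
apply: (@le_trans _ _ (\sum_(a <- A) \sum_(a' <- A) K a a')); last first.
  rewrite big_seq; apply: (@le_trans _ _ (\sum_(a <- A | a \in A) W)).
    by apply: ler_sum => a ia; exact: hW.
  by rewrite -big_seq big_const_seq count_predT iter_addr addr0 -[W *+ _]mulr_natl.
rewrite big_seq [leRHS]big_seq; apply: ler_sum => a ia.
rewrite big_seq [leRHS]big_seq; apply: ler_sum => a' ia'.
have a0 : (0 < a)%N by move: ia; rewrite mem_filter => /andP[_ /smooths_ge1].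
have a'0 : (0 < a')%N by move: ia'; rewrite mem_filter => /andP[_ /smooths_ge1].
have gE c : cos (g c a - g c a') = cos (2 * pi * (c%:R * ((a%:R - a'%:R) * beta)) + 0).
  by congr cos; rewrite /g !natrM; ring.
case: (boolP ((gep p).-nat a && (gep p).-nat a')) => [/andP[ra ra']|nr]; last first.
  rewrite big_pred0 ?K0// => c; rewrite /Q; move: nr.
  by case: ((gep p).-nat a); case: ((gep p).-nat a'); rewrite ?andbF.
(* The conditions [M < c * a <= X] and [M < c * a' <= X] confine [c] to this interval. *)
apply: le_trans (hK a a' (maxn N (maxn (M %/ a).+1 (M %/ a').+1))
    (minn (N * y) (minn (X %/ a).+1 (X %/ a').+1)) ia ia' _); last first.
  by rewrite (leq_trans (leq_subr _ _))// geq_minl.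
rewrite -big_nat_between le_eqVlt; apply/orP; left; apply/eqP; apply: eq_big => [c|c _]; last exact: gE.
rewrite /Q ra ra' /= geq_max leq_min !ltnS.
rewrite !ltn_divLR// !leq_divRL//; lia.
Qed.
End bilinear.

(** * Geometric sums sorted by position modulo 1 *)

Section cells.
Context {R : realType}.

Lemma harmonic_le n : \sum_(0 <= c < n.+1) (c%:R : R)^-1 <= 1 + ln n%:R.
Proof.
elim: n => [|n IH]; first by rewrite big_nat1 invr0 ln0// addr0.
rewrite big_nat_recr//=; case: n IH => [|n] IH.
  by rewrite big_nat1 invr0 add0r ln1 addr0 invr1.
apply: (le_trans (lerD IH (lexx _))); rewrite -addrA lerD2l.
have e : (n.+1%:R : R) = n.+2%:R * (1 + - n.+2%:R^-1).
  by rewrite mulrDr mulr1 mulrN divff// -[n.+2%:R]natr1 addrK.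
have v1 : n.+2%:R^-1 < 1 :> R by rewrite invf_lt1 ?ltr1n.
rewrite {1}e lnM ?posrE ?subr_gt0//; have := @le_ln1Dx R (- n.+2%:R^-1).
rewrite ltrN2 v1 => /(_ isT).
set a := ln (1 - _); set b := _^-1; set c := ln _; clearbody a b c; lra.
Qed.

Definition cell (L : nat) (t : R) : nat := Num.truncn (L%:R * frac t).

Lemma cell_lt L t : (0 < L)%N -> (cell L t < L)%N.
Proof.
move=> L0; rewrite -(ltr_nat R) (@le_lt_trans _ _ (L%:R * frac t))//.
  by rewrite truncn_le mulr_ge0// frac_ge0.
by rewrite -[ltRHS]mulr1 ltr_pM2l ?ltr0n// frac_lt1.
Qed.

Lemma cell_ge L t : (0 < L)%N -> (cell L t)%:R / L%:R <= frac t.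
Proof.
move=> L0; rewrite ler_pdivrMr ?ltr0n// mulrC truncn_le mulr_ge0//.
exact: frac_ge0.
Qed.

Lemma cell_gt L t : (0 < L)%N -> frac t < (cell L t).+1%:R / L%:R.
Proof. by move=> L0; rewrite ltr_pdivlMr ?ltr0n// mulrC truncnS_gt. Qed.

(* An upper bound for [min(L, 1/|t|)] on the [c]-th cell; the junk value
   [1/0 = 0] is harmless at the two end cells. *)
Definition cell_bound (L c : nat) : R :=
  L%:R * (c == 0)%:R + L%:R * (c == L.-1)%:R +
  2 * L%:R * c%:R^-1 + 2 * L%:R * (L.-1 - c)%N%:R^-1.

Lemma cell_bound_ge0 L c : 0 <= cell_bound L c.
Proof. by rewrite !addr_ge0// !mulr_ge0// invr_ge0. Qed.

(** A point of cell [c] is at distance at least [min(c, L - 1 - c) / L] from the integers, since the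
    cell ends at [(c + 1) / L]. In the two end cells the trivial bound [L] is used. *)
Lemma sum_cos_le_cell L t u v : (0 < L)%N -> (v - u <= L)%N ->
  \sum_(u <= c < v) cos (2 * pi * (c%:R * t) + 0) <= cell_bound L (cell L t).
Proof.
move=> L0 uvL; set c := cell L t.
have t1 : 0 <= L%:R * (c == 0)%:R :> R by rewrite mulr_ge0.
have t2 : 0 <= L%:R * (c == L.-1)%:R :> R by rewrite mulr_ge0.
have t3 : 0 <= 2 * L%:R * c%:R^-1 :> R by rewrite !mulr_ge0// invr_ge0.
have t4 : 0 <= 2 * L%:R * (L.-1 - c)%N%:R^-1 :> R by rewrite !mulr_ge0// invr_ge0.
have triv : \sum_(u <= i < v) cos (2 * pi * (i%:R * t) + 0) <= L%:R.
  apply: (@le_trans _ _ (\sum_(u <= i < v) 1)).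
    by apply: ler_sum => i _; exact: cos_le1.
  by rewrite sumr_const_nat ler_nat.
rewrite /cell_bound; case: (eqVneq c 0) => c0; first by rewrite mulr1; lra.
case: (eqVneq c L.-1) => c1; first by rewrite mulr1 mulr0; lra.
have cL : (c < L)%N := cell_lt t L0.
have LR : 0 < L%:R :> R by rewrite ltr0n.
have c0R : 0 < c%:R :> R by rewrite ltr0n lt0n.
have c1R : 0 < (L.-1 - c)%N%:R :> R by rewrite ltr0n; lia.
have f1 : c%:R / L%:R <= frac t := cell_ge t L0.
have f2 : (L.-1 - c)%N%:R / L%:R <= 1 - frac t.
  have := cell_gt t L0; rewrite -/c => h.
  have -> : (L.-1 - c)%N%:R / L%:R = 1 - c.+1%:R / L%:R :> R.
    rewrite (_ : L.-1 - c = L - c.+1)%N; last by rewrite -subn1 -subnDA add1n.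
    by rewrite natrB// mulrBl divff ?gt_eqF.
  lra.
rewrite !mulr0 !add0r; apply: (le_trans (ler_norm _)).
pose r : R := Num.min (c%:R / L%:R) ((L.-1 - c)%N%:R / L%:R).
have r0 : 0 < r by rewrite lt_min !divr_gt0.
apply: (le_trans (norm_sum_cos_le (r := r) _ _ _ r0 _)).
  by move=> k; apply: le_trans (min_frac_le t k); rewrite le_min2.
rewrite /r minElt; case: ifP => _; rewrite invf_div mulrA; lra.
Qed.

Lemma sum_cell_bound L : (0 < L)%N ->
  \sum_(0 <= c < L) cell_bound L c <= L%:R * (6 + 4 * ln L%:R).
Proof.
move=> L0; have LR : 0 < L%:R :> R by rewrite ltr0n.
have hL : \sum_(0 <= c < L) (c%:R : R)^-1 <= 1 + ln L%:R.
  apply: le_trans (harmonic_le L); rewrite big_nat_recr//= lerDl invr_ge0//.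
rewrite !big_split/= -!mulr_sumr.
have one i : (i < L)%N -> \sum_(0 <= c < L) (c == i)%:R = 1 :> R.
  move=> iL; rewrite (bigD1_seq i) ?iota_uniq ?mem_index_iota//= eqxx.
  by rewrite big1 ?addr0// => j /negPf->.
rewrite !one ?prednK//.
have -> : \sum_(0 <= c < L) ((L.-1 - c)%N%:R : R)^-1 = \sum_(0 <= c < L) (c%:R : R)^-1.
  rewrite [RHS]big_nat_rev/= add0n; apply: eq_big_nat => c /andP[_ cL].
  by congr (_%:R^-1); lia.
set S := \sum_(_ <= _ < _) _ in hL *.
have : L%:R * S <= L%:R * (1 + ln L%:R) by rewrite ler_pM2l.
lra.
Qed.

Lemma sum_cells_le (s : seq nat) (f : nat -> nat) (h : nat -> R) (M L : nat) :
  (forall x, x \in s -> (f x < L)%N) -> (forall c, 0 <= h c) ->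
  (forall c, (count (fun x => f x == c) s <= M)%N) ->
  \sum_(x <- s) h (f x) <= M%:R * \sum_(0 <= c < L) h c.
Proof.
move=> fL h0 cM.
apply: (@le_trans _ _ (\sum_(x <- s) \sum_(0 <= c < L | f x == c) h c)).
  rewrite big_seq [leRHS]big_seq; apply: ler_sum => x xs.
  rewrite (big_rem (f x)) ?mem_index_iota ?fL//= eqxx lerDl.
  by apply: sumr_ge0.
rewrite (exchange_big_dep xpredT)//= mulr_sumr; apply: ler_sum => c _.
by rewrite big_const_seq iter_addr addr0 -[h c *+ _]mulr_natl ler_wpM2r// ler_nat.
Qed.

(** For [a1] take the least divisor above [K]: removing one of its primes, at most [y], brings it
    down to [K] or less. The alternatives with 1 cover [K = 0] and [n <= K]. *)
Lemma split_divisor n y K : (0 < y)%N -> (lep y).-nat n ->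
  exists a1 a2, [/\ n = (a1 * a2)%N, (a1 == 1)%N || (a1 <= K * y)%N
    & (a2 == 1)%N || (K < a1)%N].
Proof.
move=> y0 sn; have n0 : (0 < n)%N by case/andP: sn.
case: (posnP K) => [->|K0]; first by exists 1%N, n; rewrite mul1n orbT.
case: (leqP n K) => nK.
  exists n, 1%N; rewrite muln1 eqxx; split => //; apply/orP; right.
  by rewrite (leq_trans nK)// leq_pmulr.
pose P d := (d %| n)%N && (K < d)%N.
have exP : exists d, P d by exists n; rewrite /P dvdnn.
case: (ex_minnP exP) => d /andP[dn Kd] mind.
have d1 : (1 < d)%N by apply: leq_ltn_trans Kd.
exists d, (n %/ d)%N; rewrite mulnC divnK// Kd orbT; split => //; apply/orP; right.
have pp := pdiv_prime d1; have pd := pdiv_dvd d; set p := pdiv d in pp pd.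
have py : (p <= y)%N by move/pnatP: sn => /(_ n0 p pp); apply; apply: dvdn_trans dn.
have dpK : (d %/ p <= K)%N.
  rewrite leqNgt; apply/negP => h; have : P (d %/ p)%N.
    by rewrite /P h andbT (dvdn_trans _ dn)// -{2}(divnK pd) dvdn_mulr.
  by move=> /mind; rewrite leqNgt ltn_Pdiv ?prime_gt1// ltnW.
by rewrite -(divnK pd) leq_mul.
Qed.

End cells.

(** * Counting smooth cofactors in one cell *)

Section cell_count.
Context {R : realType}.

(** The integer [n q - d al] has absolute value at most [1/4 + 1/4], hence vanishes. So [q] divides
    [d al], thus [d], and [d (q beta - al) = q (d beta - n)] carries the bound over. *)
Lemma near_integer_dvd (beta : R) (al : int) q N X y d (n : int) :
  (0 < q)%N -> coprime `|al| q -> (0 < y)%N -> (4 * q <= N)%N ->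
  4 * X%:R * `|q%:R * beta - al%:~R| <= N%:R -> (d * N <= X)%N ->
  `|d%:R * beta - n%:~R| < (N * y)%:R^-1 ->
  (q %| d)%N /\ d%:R * `|q%:R * beta - al%:~R| * (N * y)%:R <= q%:R.
Proof.
move=> q0 cop y0 qN XN dN h; set eta := q%:R * beta - al%:~R in XN *.
have N0 : (0 < N)%N by apply: leq_trans qN; rewrite muln_gt0.
have NR : 0 < N%:R :> R by rewrite ltr0n.
have LR : 0 < (N * y)%:R :> R by rewrite ltr0n muln_gt0 N0.
have qR : 0 < q%:R :> R by rewrite ltr0n.
have e1 : (n * q%:Z - d%:Z * al)%:~R = - (q%:R * (d%:R * beta - n%:~R)) + d%:R * eta :> R.
  by rewrite intrB !intrM -!pmulrn /eta; ring.
have b1 : `|q%:R * (d%:R * beta - n%:~R)| <= 4^-1.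
  rewrite normrM (gtr0_norm qR) (@le_trans _ _ (q%:R * (N * y)%:R^-1))//.
    by rewrite ler_pM2l// ltW.
  rewrite ler_pdivrMr// mulrC ler_pdivlMr// -natrM ler_nat mulnC.
  by rewrite (leq_trans qN)// leq_pmulr.
have b2 : `|d%:R * eta| <= 4^-1.
  rewrite normrM ger0_norm// -(ler_pM2r NR).
  have : d%:R * N%:R <= X%:R :> R by rewrite -natrM ler_nat.
  move=> /(ler_wpM2r (normr_ge0 eta)); rewrite -/eta in XN; lra.
have z0 : n * q%:Z - d%:Z * al = 0.
  apply/eqP; rewrite -normr_le0 -ltzD1 add0r -(ltr_int R) intr_norm e1.
  apply: (le_lt_trans (ler_normD _ _)); rewrite normrN.
  by apply: (le_lt_trans (lerD b1 b2)); lra.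
split.
  have : (q %| d * `|al|)%N.
    have -> : (d * `|al| = `|n| * q)%N.
      by rewrite -[d in LHS]/(`|d%:Z|%N) -abszM -(subr0_eq z0) abszM.
    by rewrite dvdn_mull.
  by rewrite Gauss_dvdl// coprime_sym.
rewrite -[X in X * _ * _]ger0_norm// -normrM.
have -> : d%:R * eta = q%:R * (d%:R * beta - n%:~R).
  by move: e1; rewrite z0 mulr0z => /eqP; rewrite eq_sym addrC subr_eq0 => /eqP.
rewrite normrM (gtr0_norm qR) -mulrA -[leRHS]mulr1 ler_pM2l//.
by rewrite -ler_pdivlMr// mul1r ltW.
Qed.

(* All [a] in the cell are congruent modulo [q], hence share [g = gcd(a, q)].
   Write [a / g = a1 * a2] with [a1] just above [K]: two elements with the same
   [a2] would have [a1] congruent modulo [q / g] and too close, so [a2 <= X / D]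
   determines [a]. *)
Lemma cell_count_le (beta : R) (al : int) q N X y D (s : seq nat) :
  (0 < q)%N -> coprime `|al| q -> (0 < y)%N -> (4 * q <= N)%N ->
  4 * X%:R * `|q%:R * beta - al%:~R| <= N%:R ->
  (N <= 8 * q)%N \/ N%:R <= 8 * X%:R * `|q%:R * beta - al%:~R| ->
  (0 < D)%N -> (D <= X)%N -> (D * (16 * y ^ 4) <= N ^ 2)%N ->
  uniq s -> {subset s <= smooths (X %/ N) y} ->
  (forall a, a \in s -> (X < a * (N * y) * y ^ 2)%N) ->
  (forall a a', a \in s -> a' \in s -> exists n : int,
     `|(a%:R - a'%:R) * beta - n%:~R| < (N * y)%:R^-1) ->
  (size s <= size (smooths (X %/ D) y))%N.
Proof.
move=> q0 cop y0 qN XN Nq D0 DX DN us sub big near.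
set De := `|_| in XN Nq.
have N0 : (0 < N)%N by apply: leq_trans qN; rewrite muln_gt0.
have sm a : a \in s -> [/\ (0 < a)%N, (a * N <= X)%N & (lep y).-nat a].
  by move=> /sub; rewrite mem_smooths leq_divRL// => /and3P[].
have sep a a' : a \in s -> a' \in s -> (a' <= a)%N ->
   (q %| a - a')%N /\ (a - a')%N%:R * De * (N * y)%:R <= q%:R.
  move=> ia ia' le; have [n hn] := near a a' ia ia'.
  apply: (@near_integer_dvd beta al q N X y (a - a')%N n) => //; last by rewrite natrB.
  by have [_ h _] := sm a ia; apply: leq_trans h; rewrite leq_mul2r leq_subr orbT.
case Es : s => [|a0 s'] //; rewrite -Es.
have ia0 : a0 \in s by rewrite Es mem_head.
pose g := gcdn a0 q.
have g0 : (0 < g)%N by rewrite gcdn_gt0 q0 orbT.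
have gE a : a \in s -> gcdn a q = g.
  move=> ia; rewrite /g -gcdn_modl -[in RHS]gcdn_modl; congr gcdn; apply/eqP.
  case: (leqP a0 a) => [le|/ltnW le].
    by rewrite eqn_mod_dvd//; case: (sep a a0 ia ia0 le).
  by rewrite eq_sym eqn_mod_dvd//; case: (sep a0 a ia0 ia le).
pose E := (16 * y ^ 4)%N.
have E0 : (0 < E)%N by rewrite muln_gt0 expn_gt0 y0.
(* Calibrated so that two elements with the same [a2] contradict [Nq], while [K < a1] still forces
   [a2 <= X / D]. *)
pose K := (N %/ (E * g))%N.
have KE : (K * (E * g) <= N)%N by rewrite leq_trunc_div.
have KE' : (N < K.+1 * (E * g))%N by rewrite ltn_ceil// muln_gt0 E0.
have [F hF] : exists F : nat -> nat * nat, forall a, a \in s ->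
   [/\ (a %/ g = (F a).1 * (F a).2)%N, ((F a).1 == 1)%N || ((F a).1 <= K * y)%N
    & ((F a).2 == 1)%N || (K < (F a).1)%N].
  suff : forall a, exists u : nat * nat, a \in s ->
   [/\ (a %/ g = u.1 * u.2)%N, (u.1 == 1)%N || (u.1 <= K * y)%N
    & (u.2 == 1)%N || (K < u.1)%N] by move=> /choice[F hF]; exists F.
  move=> a; case: (boolP (a \in s)) => ia; last by exists (0, 0)%N.
  have [_ _ sa] := sm a ia.
  have [|a1 [a2 h]] := @split_divisor (a %/ g) y K y0.
    by apply: pnat_dvd sa; rewrite -(gE a ia) dvdn_div ?dvdn_gcdl.
  by exists (a1, a2).
have aE a : a \in s -> a = (g * ((F a).1 * (F a).2))%N.
  by move=> ia; have [<- _ _] := hF a ia; rewrite mulnC divnK// -(gE a ia) dvdn_gcdl.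
have inj a a' : a \in s -> a' \in s -> (a' <= a)%N -> (F a).2 = (F a').2 -> a = a'.
  move=> ia ia' le eF; apply/eqP; rewrite eqn_leq le andbT leqNgt; apply/negP => lt.
  have [qd hd] := sep a a' ia ia' le.
  have := aE a ia; have := aE a' ia'; have [h1' h1 _] := hF a ia; rewrite -eF.
  have ga : (gcdn a q = g)%N by apply: gE.
  have [a00 _ _] := sm a ia; have [a'00 _ _] := sm a' ia'.
  have := big a ia; move: h1' ; move: h1; case: (F a) => a1 a2 /=; set b1 := (F a').1 => h1 eag biga ea' ea.
  have a20 : (0 < a2)%N by move: a00; rewrite ea !muln_gt0 => /and3P[].
  have b10 : (0 < b1)%N by move: a'00; rewrite ea' !muln_gt0 => /and3P[].
  have lt1 : (b1 < a1)%N by move: lt; rewrite ea ea' ltn_mul2l ltn_mul2r => /and3P[].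
  have a1K : (a1 <= K * y)%N by move: h1; case: eqP => // e; rewrite e ltnS leqNgt b10 in lt1.
  have dE : (a - a' = g * (a2 * (a1 - b1)))%N.
    by rewrite ea ea' -mulnBr -mulnBl [(_ * a2)%N]mulnC.
  have gq : (g %| q)%N by rewrite -ga dvdn_gcdr.
  (* As [g] is the full gcd of [a] and [q], the factor [a2] is coprime to [q / g] and cancels from
     [a - a' = g a2 (a1 - b1)]. *)
  have qdiv : (q %/ g %| a1 - b1)%N.
    have cp : coprime (q %/ g) a2.
      have : coprime (a %/ g) (q %/ g).
        rewrite /coprime -(eqn_pmul2r g0) mul1n muln_gcdl !divnK ?ga//.
        by rewrite -ga dvdn_gcdl.
      by rewrite eag coprimeMl => /andP[_]; rewrite coprime_sym.
    rewrite -(Gauss_dvdr _ cp) -(dvdn_pmul2l g0) -dE mulnC divnK//.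
  have qle : (q <= g * (a1 - b1))%N.
    by rewrite -{1}(divnK gq) mulnC leq_mul2l dvdn_leq ?orbT// subn_gt0.
  have qK : (q <= g * (K * y))%N.
    by rewrite (leq_trans qle)// leq_mul2l (leq_trans (leq_subr _ _) a1K) orbT.
  (* If [N <= 8 q], then [q <= g K y] already contradicts the choice of [K]. Otherwise the second
     conclusion of [sep] yields [a De N y <= g K y], and [big] makes [a] too large for that. *)
  case: Nq => Nq.
    have : (q * E <= N * y)%N.
      apply: (@leq_trans (g * (K * y) * E)); first by rewrite leq_mul2r qK orbT.
      have -> : (g * (K * y) * E = K * (E * g) * y)%N by ring.
      by rewrite leq_mul2r KE orbT.
    rewrite leqNgt => /negP; apply; apply: (@leq_ltn_trans (8 * q * y)).
      by rewrite leq_mul2r Nq orbT.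
    rewrite /E [(8 * q)%N]mulnC -mulnA ltn_pmul2l//.
    have : (0 < y ^ 3)%N by rewrite expn_gt0 y0.
    by rewrite (expnS y 3); move: (y ^ 3)%N => t; clear -y0; nia.
  have qR : 0 < q%:R :> R by rewrite ltr0n.
  have NR : 0 < N%:R :> R by rewrite ltr0n.
  have De0 : 0 <= De by exact: normr_ge0.
  have LR : 0 < (N * y)%:R :> R by rewrite ltr0n muln_gt0 N0.
  have h2 : a2%:R * De * (N * y)%:R <= 1.
    rewrite -(ler_pM2l qR) mulr1; apply: le_trans hd; rewrite !mulrA.
    rewrite ler_wpM2r ?(ltW LR)// ler_wpM2r// -natrM ler_nat dE.
    by rewrite [leqRHS](_ : _ = (g * (a1 - b1)) * a2)%N; [rewrite leq_mul2r qle orbT|ring].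
  have h3 : a%:R * De * (N * y)%:R <= (g * (K * y))%:R.
    apply: (@le_trans _ _ ((g * (K * y))%:R * (a2%:R * De * (N * y)%:R))).
      rewrite !mulrA ler_wpM2r ?(ltW LR)// ler_wpM2r// -natrM ler_nat ea mulnA.
      by rewrite leq_mul2r leq_mul2l a1K !orbT.
    by rewrite -[leRHS]mulr1 ler_wpM2l.
  have XDe0 : 0 < X%:R * De by have : 0 < 8 * X%:R * De := lt_le_trans NR Nq; lra.
  have h4 : X%:R * De <= (a * (N * y) * y ^ 2)%:R * De by rewrite ler_wpM2r// ler_nat ltnW.
  have h5 : 16 * y%:R * (X%:R * De) <= N%:R.
    apply: (@le_trans _ _ (16 * y%:R * ((g * (K * y))%:R * (y ^ 2)%:R))).
      rewrite ler_wpM2l ?mulr_ge0//; apply: (le_trans h4).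
      rewrite natrM mulrAC ler_wpM2r//; apply: le_trans h3.
      by rewrite natrM mulrAC.
    rewrite -[16]/(16%:R) -!natrM ler_nat; apply: leq_trans KE; rewrite /E.
    by rewrite (_ : 16 * y * _ = K * (16 * (y * (y * y ^ 2)) * g))%N -?expnS//; ring.
  have y1 : 1 <= y%:R :> R by rewrite ler1n.
  have : 16 * (X%:R * De) <= 16 * y%:R * (X%:R * De).
    by rewrite ler_pM2r// -[leLHS]mulr1 ler_pM2l.
  lra.
rewrite -(size_map (fun a => (F a).2)); apply: uniq_leq_size.
  rewrite map_inj_in_uniq// => a a' ia ia' e.
  by case: (leqP a' a) => [|/ltnW] le; [apply: inj|symmetry; apply: inj].
move=> b /mapP[a ia ->]; have [a00 aN sa] := sm a ia; have ea := aE a ia.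
rewrite mem_smooths leq_divRL//.
have [_ _ h2] := hF a ia.
have a20 : (0 < (F a).2)%N by move: a00; rewrite [X in (0 < X)%N]ea !muln_gt0 => /and3P[].
rewrite a20 (pnat_dvd _ sa) ?andbT; last by rewrite [X in (_ %| X)%N]ea mulnA dvdn_mull.
case/orP: h2 => [/eqP->|Ka]; first by rewrite mul1n.
(* After multiplication by [E]: [a2 D E <= a2 N ^ 2 <= a2 N (g a1 E) = a N E <= X E]. *)
rewrite -(leq_pmul2r E0) -mulnA.
apply: (@leq_trans ((F a).2 * (N * N))); first by rewrite leq_mul2l -(expnSr _ 1) DN orbT.
apply: (@leq_trans ((F a).2 * (N * ((F a).1 * (E * g))))).
  rewrite !leq_mul2l (leq_trans (ltnW KE')) ?orbT// leq_mul2r Ka orbT//.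
rewrite (_ : _ * _ = g * ((F a).1 * (F a).2) * N * E)%N; last by ring.
by rewrite -ea leq_mul2r aN orbT.
Qed.

End cell_count.

(** * Dirichlet approximation and the choice of parameters *)

Section sparse_range.
Context {R : realType}.

Lemma same_cell (L : nat) (t t' : R) : (0 < L)%N -> cell L t = cell L t' ->
  exists n : int, `|t - t' - n%:~R| < L%:R^-1.
Proof.
move=> L0 e; have [i ei] := fracE t; have [j ej] := fracE t'.
exists (i - j).
have -> : t - t' - (i - j)%:~R = frac t - frac t' by rewrite {1}ei {1}ej intrB; ring.
have := cell_ge t L0; have := cell_ge t' L0; have := cell_gt t L0; have := cell_gt t' L0.
rewrite e -[(cell L t').+1%:R]natr1 mulrDl mul1r; set c := _ / _; set l := _^-1.
by clearbody c l => h1 h2 h3 h4; rewrite ltr_norml; lra.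
Qed.

(** Two of [Q + 1] multiples of [beta] share one of [Q] cells; dividing out the gcd only shrinks the
    error. *)
Lemma dirichlet (beta : R) Q : (0 < Q)%N -> exists q (al : int),
  [/\ (0 < q)%N, (q <= Q)%N, coprime `|al| q & `|q%:R * beta - al%:~R| <= Q%:R^-1].
Proof.
move=> Q0.
have [q0 [al0 [q00 qQ h]]] : exists q (al : int),
    [/\ (0 < q)%N, (q <= Q)%N & `|q%:R * beta - al%:~R| <= Q%:R^-1].
  pose s := [seq cell Q (i%:R * beta) | i <- iota 0 Q.+1].
  have : ~~ uniq s.
    apply/negP => us; have : (size s <= size (iota 0 Q))%N.
      by apply: uniq_leq_size => // x /mapP[i _ ->]; rewrite mem_iota cell_lt.
    by rewrite size_map !size_iota ltnn.
  move/(uniqPn 0%N) => [i [j [ij]]]; rewrite size_map size_iota => jQ.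
  rewrite !(nth_map 0%N) ?size_iota ?(ltn_trans ij)// !nth_iota ?(ltn_trans ij)// !add0n.
  move=> /esym /(same_cell Q0)[n hn].
  exists (j - i)%N, n; split; first by rewrite subn_gt0.
    by rewrite (leq_trans (leq_subr _ _)).
  by rewrite natrB ?(ltnW ij)// mulrBl ltW.
pose g := gcdn `|al0| q0.
have g0 : (0 < g)%N by rewrite gcdn_gt0 q00 orbT.
have gq : (g %| q0)%N by apply: dvdn_gcdr.
have ga : (g%:Z %| al0)%Z by rewrite dvdzE; apply: dvdn_gcdl.
have eq := divnK gq; have ea := divzK ga.
have q'0 : (0 < q0 %/ g)%N by rewrite divn_gt0// dvdn_leq.
exists (q0 %/ g)%N, (al0 %/ g%:Z)%Z; split => //.
- by rewrite (leq_trans (leq_div _ _)).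
- rewrite /coprime -(eqn_pmul2r g0) mul1n muln_gcdl eq.
  by rewrite -[X in (_ * X)%N]/(`|g%:Z|%N) -abszM ea.
- apply: le_trans h.
  have -> : q0%:R * beta - al0%:~R = g%:R * ((q0 %/ g)%N%:R * beta - (al0 %/ g)%Z%:~R).
    by rewrite -{1}eq -{1}ea natrM intrM -[g%:Z%:~R]/(g%:R); ring.
  by rewrite [leRHS]normrM [X in _ <= X * _]ger0_norm// ler_peMl// ler1n.
Qed.

(** Bookkeeping for [sparse_cos_sum], with [n = N], [T = N ^ sigma], [l = ln (N y)], and [P], [PN],
    [PD] the numbers of smooth integers up to [X], [X / N], [X / D]. The divisor [d P / (2 y n y)]
    is the parameter [xi], chosen to make the second term [d P / 4]. The constant is 1280 = 4 · 10 ·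
    32, the 10 from [6 + 4 l <= 10 y]. *)
Lemma sparse_numeric (y n T PN PD P d l A : R) :
  0 < d -> 1 <= y -> 1280 / d ^+ 2 <= y -> 0 < n -> 0 < T -> 0 < P ->
  0 <= A -> A <= PN -> 0 <= PD -> 0 <= l -> l <= y ->
  PN * T <= y * P -> PD * T ^+ 2 <= 32 * y ^+ 5 * P -> n ^+ 2 * y ^+ 12 <= T ^+ 3 ->
  y * ((A * (PD * (n * y * (6 + 4 * l))) / (d * P / (2 * y * (n * y)))
     + n * y * (d * P / (2 * y * (n * y)))) / 2) <= d / 2 * P.
Proof.
move=> d0 y1 yd n0 T0 P0 A0 APN PD0 l0 ly hN hD hT.
have y0 : 0 < y by lra.
have PN0 : 0 <= PN by apply: le_trans APN.
have -> : y * ((A * (PD * (n * y * (6 + 4 * l))) / (d * P / (2 * y * (n * y)))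
     + n * y * (d * P / (2 * y * (n * y)))) / 2) =
   A * PD * n ^+ 2 * y ^+ 4 * (6 + 4 * l) / (d * P) + d * P / 4.
  by field; rewrite !gt_eqF.
suff : A * PD * n ^+ 2 * y ^+ 4 * (6 + 4 * l) / (d * P) <= d * P / 4 by lra.
have dP : 0 < d * P by rewrite mulr_gt0.
rewrite ler_pdivrMr//.
have h1 : A * PD * n ^+ 2 * y ^+ 4 * (6 + 4 * l) <= 10 * (PN * PD * n ^+ 2 * y ^+ 5).
  have -> : 10 * (PN * PD * n ^+ 2 * y ^+ 5) = PN * PD * n ^+ 2 * y ^+ 4 * (10 * y) by ring.
  apply: ler_pM; last lra.
  - by rewrite !mulr_ge0// ?exprn_ge0// ltW.
  - lra.
  - rewrite -!mulrA ler_wpM2r// !mulr_ge0// ?exprn_ge0// ltW//.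
have h2 : PN * PD * T ^+ 3 <= 32 * y ^+ 6 * P ^+ 2.
  have -> : PN * PD * T ^+ 3 = (PN * T) * (PD * T ^+ 2) by ring.
  have -> : 32 * y ^+ 6 * P ^+ 2 = (y * P) * (32 * y ^+ 5 * P) by ring.
  by apply: ler_pM => //; rewrite mulr_ge0// ?exprn_ge0// ltW.
have h3 : PN * PD * n ^+ 2 * y ^+ 5 * y ^+ 7 <= 32 * y ^+ 6 * P ^+ 2.
  apply: le_trans h2; have -> : PN * PD * n ^+ 2 * y ^+ 5 * y ^+ 7 = PN * PD * (n ^+ 2 * y ^+ 12) by ring.
  by rewrite ler_wpM2l// mulr_ge0.
have h4 : PN * PD * n ^+ 2 * y ^+ 5 * y <= 32 * P ^+ 2.
  rewrite -(ler_pM2r (_ : 0 < y ^+ 6)) ?exprn_gt0//; lra.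
have h5 : 1280 <= y * d ^+ 2 by rewrite -ler_pdivrMr ?exprn_gt0.
apply: (le_trans h1); rewrite -(ler_pM2r y0).
have : 1280 * P ^+ 2 <= y * d ^+ 2 * P ^+ 2 by rewrite ler_pM2r// exprn_gt0.
have -> : d * P / 4 * (d * P) * y = y * d ^+ 2 * P ^+ 2 / 4 by ring.
set u := PN * PD * n ^+ 2 * y ^+ 5 in h4 *; lra.
Qed.

Lemma sparse_cos_sum (beta mu eta : R) : 0 < mu -> mu < 3^-1 -> 0 < eta -> eta <= 2^-1 ->
  (exists X1 : nat, forall X q (al : int), (X1 <= X)%N -> (0 < q)%N ->
     X%:R `^ eta <= q%:R \/ X%:R `^ eta <= X%:R * `|q%:R * beta - al%:~R|) ->
  exists k : nat, forall d : R, 0 < d -> exists X0 : nat, forall X y, (X0 <= X)%N ->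
    ln X%:R <= y%:R `^ mu -> (y ^ k < X)%N -> forall phi,
    `|\sum_(m <- smooths X y) cos (2 * pi * (m%:R * beta) + phi)|
      <= d * (size (smooths X y))%:R.
Proof.
move=> mu0 mu3 eta0 eta2 [X1 hX1].
(* Half of the slack [1/3 - mu] lifts [sigma] above 2/3; the other half keeps [mu + sigma < 1]. *)
pose rho := (3^-1 - mu) / 2; pose sigma := 2 / 3 + rho.
have rho0 : 0 < rho by rewrite /rho; lra.
have s0 : 0 <= sigma <= 1 by rewrite /sigma /rho; lra.
have ms : mu + sigma < 1 by rewrite /sigma /rho; lra.
have [y1 hy1] := smooths_ratio (ltW mu0) s0 ms.
have rho6 : rho <= 6^-1 by rewrite /rho; lra.
have re0 : 0 < rho * eta by rewrite mulr_gt0.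
(* Then [N >= X ^ eta >= y ^ (k eta)] gives [N ^ (3 rho) >= y ^ 12], the power of [y] demanded by
   [sparse_numeric]. *)
pose k := (Num.truncn (4 / (rho * eta))).+1.
have hk : 4 <= k%:R * (rho * eta).
  by rewrite -ler_pdivrMr// ltW// truncnS_gt.
exists k => d d0.
have [y2 y21 hy2] := @powR_large R 3^-1 (2 / d) ltac:(lra).
pose Y := maxn y1 (maxn 144 (maxn (Num.truncn y2).+1 (Num.truncn (1280 / d ^+ 2)).+1)).
exists (maxn X1 (maxn 2 (Num.truncn (expR (Y%:R : R))).+1)) => X y.
rewrite !geq_max => /and3P[XX1 X2 XY] lX ykX phi.
have XR : 0 < X%:R :> R by rewrite ltr0n (ltn_trans _ X2).
have y0 : (0 < y)%N.
  rewrite lt0n; apply/eqP => e; move: lX; rewrite e powR0 ?gt_eqF// leNgt.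
  by rewrite ln_gt0// ltr1n.
have yR1 : 1 <= y%:R :> R by rewrite ler1n.
have lXy : ln X%:R <= y%:R :> R.
  by apply: (le_trans lX); apply: ler1_powR => //; lra.
(* Because [ln X <= y ^ mu <= y], a large [X] forces a large [y]. *)
have Yy : (Y <= y)%N.
  rewrite -(ler_nat R) (le_trans _ lXy)// -[leLHS]expRK ler_ln ?posrE ?expR_gt0//.
  by rewrite ltW// (lt_le_trans (truncnS_gt _))// ler_nat.
move: Yy; rewrite !geq_max => /and4P[yy1 y144 yy2 yyd].
have yR : 0 < y%:R :> R by rewrite ltr0n.
set P : R := (size (smooths X y))%:R.
have P0 : 0 < P by rewrite ltr0n size_smooths_gt0// (ltn_trans _ X2).
have ratio D := hy1 X y yy1 lX D; rewrite -/P in ratio.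
pose Q := (Num.truncn (Num.sqrt (X%:R : R))).+1.
have sX : Num.sqrt (X%:R : R) ^+ 2 = X%:R by rewrite sqr_sqrtr.
have sX0 : 0 <= Num.sqrt (X%:R : R) by rewrite sqrtr_ge0.
have sX1 : 1 <= Num.sqrt (X%:R : R).
  by rewrite -[leLHS]sqrtr1 ler_wsqrtr// ler1n ltnW.
have QX : Num.sqrt (X%:R : R) <= Q%:R by rewrite ltW// truncnS_gt.
have XQ : Q%:R <= 2 * Num.sqrt (X%:R : R).
  rewrite /Q -natr1; have : (Num.truncn (Num.sqrt (X%:R : R)))%:R <= Num.sqrt (X%:R : R).
    by rewrite truncn_le.
  by clear -sX1; lra.
have [q [al [q0 qQ cop hDe]]] := dirichlet beta (ltn0Sn _ : (0 < Q)%N).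
set De := `|_| in hDe.
have De0 : 0 <= De by exact: normr_ge0.
have XDe : X%:R * De <= Num.sqrt (X%:R : R).
  apply: (@le_trans _ _ (X%:R / Q%:R)); first by rewrite ler_pM2l.
  by rewrite ler_pdivrMr ?ltr0n// -{1}sX expr2 ler_wpM2l.
set t := (Num.truncn (X%:R * De)).+1.
(* The factor 4 and the successor in [t] secure the lower bounds on [N] in [cell_count_le], while
   [Nq] records that [N] is at most 8 times [q] or 8 times [X De]. *)
pose N := (4 * maxn q t)%N.
have qN : (4 * q <= N)%N by rewrite leq_mul2l leq_maxl.
have XDe0 : 0 <= X%:R * De by rewrite mulr_ge0.
have XN : 4 * X%:R * De <= N%:R.
  rewrite /N natrM -mulrA ler_pM2l// ltW// (lt_le_trans (truncnS_gt _))//.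
  by rewrite ler_nat leq_maxr.
have Nq : (N <= 8 * q)%N \/ N%:R <= 8 * X%:R * De.
  rewrite /N; case: (leqP t q) => h.
    by left; rewrite leq_mul2r orbT.
  right; rewrite natrM /t -natr1.
  have : 1 <= (Num.truncn (X%:R * De))%:R :> R.
    by rewrite ler1n -ltnS (leq_trans _ h)// ltnS.
  have : (Num.truncn (X%:R * De))%:R <= X%:R * De by rewrite truncn_le.
  by rewrite -[8 * _ * _]mulrA; clear; lra.
have NX : N%:R <= 12 * Num.sqrt (X%:R : R).
  case: Nq => h; last by rewrite -mulrA in h; clear -h XDe sX0; lra.
  have qle : q%:R <= 2 * Num.sqrt (X%:R : R) by rewrite (le_trans _ XQ)// ler_nat.
  rewrite /N natrM; have [hm|hm] : maxn q t = q \/ maxn q t = t.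
    by case: (leqP t q); [left|right].
    by rewrite hm; clear -qle sX0; lra.
  have : (Num.truncn (X%:R * De))%:R <= X%:R * De by rewrite truncn_le.
  by rewrite hm /t -natr1; clear -XDe sX1; lra.
have NX2 : (N ^ 2 <= 144 * X)%N.
  have : N%:R ^+ 2 <= (12 * Num.sqrt (X%:R : R)) ^+ 2.
    by rewrite lerXn2r ?nnegrE ?mulr_ge0.
  by rewrite exprMn sX -!natrX -natrM ler_nat.
have N4 : (4 <= N)%N by rewrite (leq_trans _ qN)// leq_pmulr.
have N0 : (0 < N)%N by apply: leq_trans N4.
have NR : 0 < N%:R :> R by rewrite ltr0n.
have Neta : X%:R `^ eta <= N%:R.
  case: (hX1 X q al XX1 q0) => h; apply: (le_trans h).
    by rewrite ler_nat (leq_trans _ qN)// leq_pmull.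
  by apply: le_trans XN; rewrite -/De -mulrA ler_peMl// ler1n.
have ykR : y%:R `^ k%:R <= X%:R :> R by rewrite powR_mulrn// -natrX ler_nat ltnW.
have Nrho : y%:R ^+ 12 <= N%:R `^ (3 * rho) :> R.
  apply: (@le_trans _ _ ((y%:R `^ k%:R) `^ (eta * (3 * rho)))).
    rewrite -powRrM -powR_mulrn// ler_powR//.
    have -> : k%:R * (eta * (3 * rho)) = 3 * (k%:R * (rho * eta)) by ring.
    by clear -hk; lra.
  rewrite powRrM; apply: ge0_ler_powR; rewrite ?nnegrE ?powR_ge0 ?ler0n//.
    by rewrite mulr_ge0// ltW.
  apply: le_trans Neta; apply: ge0_ler_powR; rewrite ?nnegrE ?powR_ge0 ?ler0n//.
  exact: ltW.
have Ny4 : (y ^ 4 <= N)%N.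
  rewrite -(ler_nat R) natrX (le_trans _ Neta)//.
  apply: (@le_trans _ _ ((y%:R `^ k%:R) `^ eta)).
    rewrite -powRrM -powR_mulrn// ler_powR//.
    have : k%:R * (rho * eta) <= k%:R * (6^-1 * eta) by rewrite ler_wpM2l// ler_pM2r.
    have : 0 <= k%:R * eta by rewrite mulr_ge0// ltW.
    by clear -hk; lra.
  by apply: ge0_ler_powR; rewrite ?nnegrE ?powR_ge0 ?ler0n// ltW.
have k5 : (5 <= k)%N.
  rewrite -(ler_nat R); have kk : 0 <= k%:R :> R by [].
  have : k%:R * (rho * eta) <= k%:R * (6^-1 * 2^-1).
    by rewrite ler_wpM2l//; apply: ler_pM => //; apply: ltW.
  by clear -hk kk; lra.
have y5X : (y ^ 5 <= X)%N by rewrite (leq_trans _ (ltnW ykX))// leq_pexp2l.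
have Ny2 : (N * y ^ 2 <= X)%N.
  rewrite -(@leq_exp2r _ _ 2)// expnMn -expnM.
  apply: (@leq_trans (144 * X * y ^ 4)); first by rewrite leq_mul2r NX2 orbT.
  have -> : (144 * X * y ^ 4 = 144 * y ^ 4 * X)%N by ring.
  rewrite -[leqRHS]mulnn leq_mul2r; apply/orP; right; apply: leq_trans y5X.
  by rewrite expnS leq_mul2r y144 orbT.
have NyX : (N * y <= X)%N.
  by apply: leq_trans Ny2; rewrite leq_mul2l -[X in (X <= _)%N]expn1 leq_pexp2l ?orbT.
(* The [m <= M] are bounded trivially; [m > M] keeps [a N y] above [X / y ^ 2], as the cell count
   requires. [D] is the largest value allowed there. *)
pose M := (X %/ y ^ 2)%N; pose L := (N * y)%N; pose D := (N ^ 2 %/ (16 * y ^ 4))%N.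
have NM : (N <= M.+1)%N by rewrite leqW// leq_divRL// expn_gt0 y0.
have L0 : (0 < L)%N by rewrite muln_gt0 N0.
have E0 : (0 < 16 * y ^ 4)%N by rewrite muln_gt0 expn_gt0 y0.
have EN : (16 * y ^ 4 <= N ^ 2)%N.
  rewrite -[leqRHS]mulnn leq_mul//; apply: leq_trans Ny4.
  by rewrite -[y in leqRHS]expn1 (leq_trans (_ : 16 <= y)%N) ?(leq_trans _ y144)// -[leqLHS]expn1 leq_pexp2l.
have D0 : (0 < D)%N by rewrite divn_gt0.
have DE : (D * (16 * y ^ 4) <= N ^ 2)%N by rewrite leq_trunc_div.
have DX : (D <= X)%N.
  rewrite -(leq_pmul2r E0); apply: (leq_trans DE); apply: (leq_trans NX2).
  rewrite mulnC leq_mul2l; apply/orP; right; rewrite mulnC.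
  by rewrite (leq_trans y144)// -[leqLHS]expn1 (leq_trans (_ : _ <= y ^ 4)%N) ?leq_pexp2l// leq_pmulr.
pose A := [seq a <- smooths (X %/ N) y | (M < a * L)%N].
pose PN : R := (size (smooths (X %/ N) y))%:R.
pose PD : R := (size (smooths (X %/ D) y))%:R.
pose K (a a' : nat) : R := cell_bound L (cell L ((a%:R - a'%:R) * beta)).
pose W : R := PD * (L%:R * (6 + 4 * ln L%:R)).
pose T : R := N%:R `^ sigma.
have T0 : 0 < T by rewrite powR_gt0.
have LNy : L%:R = N%:R * y%:R :> R by rewrite natrM.
pose xi : R := d * P / (2 * y%:R * (N%:R * y%:R)).
have xi0 : 0 < xi by rewrite divr_gt0 ?mulr_gt0.
have hW a : a \in A -> \sum_(a' <- A) K a a' <= W.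
  move=> ia; apply: (@le_trans _ _ (PD * \sum_(0 <= c < L) cell_bound L c)); last first.
    by rewrite ler_wpM2l// sum_cell_bound.
  apply: (sum_cells_le (f := fun a' => cell L ((a%:R - a'%:R) * beta))).
  - by move=> a' _; apply: cell_lt.
  - by move=> c; apply: cell_bound_ge0.
  move=> c; rewrite -size_filter.
  apply: (cell_count_le (beta := beta) (al := al) (q := q) (N := N)) => //.
  - by rewrite !filter_uniq ?iota_uniq.
  - by move=> a'; rewrite !mem_filter => /and3P[_ _]; rewrite -mem_filter.
  - move=> a'; rewrite mem_filter => /andP[_]; rewrite mem_filter => /andP[h _].
    by rewrite -ltn_divLR// expn_gt0 y0.
  (* The common [a] cancels: two elements of one cell have [(a1 - a2) beta] within [1 / L] of an
     integer. *)
  move=> a1 a2; rewrite !mem_filter => /and3P[/eqP h1 _ _] /and3P[/eqP h2 _ _].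
  have [n hn] := same_cell L0 (etrans h2 (esym h1)).
  by exists n; rewrite (_ : (a1%:R - a2%:R) * beta = (a%:R - a2%:R) * beta - (a%:R - a1%:R) * beta)//; ring.
have hK a a' u v : a \in A -> a' \in A -> (v - u <= N * y)%N ->
    \sum_(u <= c < v) cos (2 * pi * (c%:R * ((a%:R - a'%:R) * beta)) + 0) <= K a a'.
  by move=> _ _; apply: sum_cos_le_cell.
have main := bilinear_cos_sum phi (leq_trans (isT : 1 < 4)%N N4) NM xi0 hK hW.
have hPN : PN * T <= y%:R * P := ratio N.
have hPD : PD * T ^+ 2 <= 32 * y%:R ^+ 5 * P.
  have D1 : (N ^ 2 <= D * (32 * y ^ 4))%N.
    rewrite (leq_trans (ltnW (ltn_ceil _ E0)))// -/D -addn1 mulnDl mul1n.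
    by rewrite (_ : D * (32 * y ^ 4) = D * (16 * y ^ 4) + D * (16 * y ^ 4))%N; [rewrite leq_add2l leq_pmull|ring].
  have h1 : T ^+ 2 <= D%:R `^ sigma * (32 * y%:R ^+ 4).
    rewrite expr2 /T -powRM// -expr2 -natrX.
    apply: (@le_trans _ _ ((D * (32 * y ^ 4))%:R `^ sigma)).
      by case/andP: s0 => s0 _; apply: ge0_ler_powR; rewrite ?nnegrE// ler_nat.
    rewrite natrM powRM// ler_wpM2l ?powR_ge0// -natrX -natrM.
    case/andP: s0 => _ s1; apply: ler1_powR => //.
    by rewrite ler1n muln_gt0 expn_gt0 y0.
  apply: (@le_trans _ _ (PD * (D%:R `^ sigma * (32 * y%:R ^+ 4)))); first by rewrite ler_wpM2l.
  rewrite mulrA; apply: (@le_trans _ _ (y%:R * P * (32 * y%:R ^+ 4))).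
    by rewrite ler_wpM2r ?ratio// mulr_ge0// exprn_ge0.
  by rewrite le_eqVlt; apply/orP; left; apply/eqP; ring.
have hT : N%:R ^+ 2 * y%:R ^+ 12 <= T ^+ 3.
  have -> : T ^+ 3 = N%:R ^+ 2 * N%:R `^ (3 * rho).
    rewrite -!powR_mulrn ?powR_ge0// /T -powRrM -powRD ?(gt_eqF NR) ?implybT//.
    by congr powR; rewrite /sigma; field.
  by apply: ler_wpM2l => //; rewrite exprn_ge0.
have lL : ln L%:R <= y%:R :> R.
  by apply: le_trans lXy; apply: le_ln_nat.
have AN : (size A)%:R <= PN by rewrite ler_nat size_filter count_size.
have yd' : 1280 / d ^+ 2 <= y%:R.
  by rewrite ltW// (lt_le_trans (truncnS_gt _))// ler_nat.
have {}main : `|\sum_(m <- smooths X y | (M < m)%N) cos (2 * pi * (m%:R * beta) + phi)| <= d / 2 * P.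
  apply: (le_trans main); rewrite -/A -/L LNy /W LNy.
  rewrite -LNy; have lL0 := ln_nat_ge0 (R := R) L; rewrite LNy.
  rewrite LNy in lL lL0.
  exact: (sparse_numeric d0 yR1 yd' NR T0 P0 _ AN _ lL0 lL hPN hPD hT).
have small : `|\sum_(m <- smooths X y | ~~ (M < m)%N) cos (2 * pi * (m%:R * beta) + phi)| <= d / 2 * P.
  apply: (@le_trans _ _ (size (smooths M y))%:R).
    apply: (le_trans (ler_norm_sum _ _ _)).
    apply: (@le_trans _ _ (\sum_(m <- smooths X y | ~~ (M < m)%N) 1)).
      by apply: ler_sum => m _; apply: cos_max.
    rewrite -big_filter big_const_seq count_predT iter_addr addr0 ler_nat.
    apply: uniq_leq_size; first by rewrite filter_uniq ?smooths_uniq.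
    move=> m; rewrite mem_filter !mem_smooths -leqNgt => /and4P[-> -> _ ->] //.
  have h := ratio (y ^ 2)%N.
  (* One factor [y] cancels the loss in [smooths_ratio]; the remaining exponent [2 sigma - 1]
     exceeds 1/3, so this power beats [2 / d]. *)
  have e : (y ^ 2)%:R `^ sigma = y%:R * y%:R `^ (2 * sigma - 1) :> R.
    rewrite natrX -powR_mulrn// -powRrM -{2}[y%:R]powRr1// -powRD ?(gt_eqF yR) ?implybT//.
    by congr powR; ring.
  rewrite e mulrCA ler_pM2l// in h.
  have h3 : 2 / d <= y%:R `^ (2 * sigma - 1).
    apply: (@le_trans _ _ (y%:R `^ 3^-1)).
      by apply: hy2; rewrite ltW// (lt_le_trans (truncnS_gt _))// ler_nat.
    by apply: ler_powR => //; rewrite /sigma; clear -rho0; lra.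
  have : (size (smooths M y))%:R * (2 / d) <= P.
    by apply: le_trans h; rewrite ler_wpM2l.
  rewrite mulrA ler_pdivrMr// => h4.
  by rewrite mulrAC ler_pdivlMr// [d * P]mulrC.
rewrite (bigID (fun m => M < m)%N)/=; apply: (le_trans (ler_normD _ _)).
by apply: (le_trans (lerD main small)); rewrite -mulrDl -splitr.
Qed.

End sparse_range.

(** * Beatty sequences *)

Section weyl_sums.
Context {R : realType}.

Lemma dist_int_le (t : R) (k : int) : dist_int t <= `|t - k%:~R|.
Proof.
apply: ge_inf; last by exists k.
by exists 0 => _ [j _ <-]; exact: normr_ge0.
Qed.

Section finite_type.
Variables (theta : R) (h : nat).
Hypothesis theta1 : 1 < theta.
Hypothesis ft : finite_type theta.
Hypothesis h0 : (0 < h)%N.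

Let theta0 : 0 < theta. Proof. exact: lt_trans theta1. Qed.
Let hR : 0 < h%:R :> R. Proof. by rewrite ltr0n. Qed.

(** If [n h / theta] were an integer [j], then [j theta = n h] would be at distance 0 from the
    integers, against the positive lower bound. *)
Lemma finite_type_irrational n : (0 < n)%N ->
  forall j : int, n%:R * (h%:R / theta) != j%:~R.
Proof.
move=> n0 j; have [c [kappa [c0 kappa0 hc]]] := ft.
have nR : 0 < n%:R :> R by rewrite ltr0n.
apply/eqP => e.
have j0 : 0 < j%:~R :> R by rewrite -e mulr_gt0// divr_gt0.
rewrite ltr0z in j0; case: j j0 e => // j j0 e.
have := hc j j0; apply/negP; rewrite -ltNge.
apply: (le_lt_trans (dist_int_le _ (n * h)%N)).
have -> : j%:R * theta - (n * h)%N%:~R = 0 :> R.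
  rewrite -[(n * h)%N%:~R]/((n * h)%:R) natrM.
  by move: e; rewrite -[j%:~R]/(j%:R) => <-; field; rewrite gt_eqF.
by rewrite normr0 mulr_gt0// powR_gt0// ltr0n.
Qed.

(** The identity [|al theta - q h| = theta |q h / theta - al|] carries the finite type bound from
    [theta] to [h / theta]; the multiplier [al] is at most [2 h q] in the case that matters. *)
Lemma finite_type_approx : exists2 eta : R, 0 < eta <= 2^-1 &
  exists X1 : nat, forall X q (al : int), (X1 <= X)%N -> (0 < q)%N ->
     X%:R `^ eta <= q%:R \/ X%:R `^ eta <= X%:R * `|q%:R * (h%:R / theta) - al%:~R|.
Proof.
have [c [kappa [c0 kappa0 hc]]] := ft.
(* This makes [1 - eta kappa = 2 eta]: for [q < X ^ eta] the result is [X De >= C X ^ (2 eta)], and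
   the spare [X ^ eta] absorbs [C]. *)
pose eta := (kappa + 2)^-1.
have eta0 : 0 < eta by rewrite invr_gt0; lra.
have eta2 : eta <= 2^-1 by rewrite lef_pV2 ?posrE; lra.
have ek : 1 - eta * kappa = eta + eta.
  by rewrite /eta; field; rewrite gt_eqF//; lra.
pose C := c / theta * (2 * h%:R) `^ (- kappa).
have C0 : 0 < C by rewrite mulr_gt0 ?divr_gt0// powR_gt0// mulr_gt0.
exists eta; first by rewrite eta0.
have [x1 x11 hx1] := powR_large (Num.max theta C^-1) eta0.
exists (Num.truncn x1).+1 => X q al XX q0.
have Xx1 : x1 <= X%:R by rewrite ltW// (lt_le_trans (truncnS_gt _))// ler_nat.
have X1 : 1 <= X%:R :> R by apply: le_trans Xx1.
have XR : 0 < X%:R :> R by lra.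
have qR : 0 < q%:R :> R by rewrite ltr0n.
have qR1 : 1 <= q%:R :> R by rewrite ler1n.
have hR1 : 1 <= h%:R :> R by rewrite ler1n.
have := hx1 X%:R Xx1; rewrite ge_max => /andP[Xth XC].
have E0 : 0 < X%:R `^ eta by rewrite powR_gt0.
have XE : X%:R `^ eta * X%:R `^ eta <= X%:R.
  by rewrite -powRD ?(gt_eqF XR) ?implybT//; apply: ler1_powR => //; lra.
case: (leP (X%:R `^ eta) q%:R) => [|qX]; [by left|right].
set De := `|_|.
have De0 : 0 <= De by exact: normr_ge0.
have [De1|De1] := leP 1 De.
  apply: (@le_trans _ _ X%:R); first by apply: ler1_powR => //; lra.
  by rewrite ler_peMr// ltW.
have dE : `|al%:~R * theta - (q * h)%N%:~R| = theta * De.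
  rewrite -[X in X * De]gtr0_norm// -normrM -normrN; congr `|_|.
  by rewrite -[(q * h)%N%:~R]/((q * h)%:R) natrM; field; rewrite gt_eqF.
have [al0|al0] := leP al 0.
  have a0 : al%:~R <= 0 :> R by rewrite lerz0.
  have : theta^-1 <= De.
    have qb : theta^-1 <= q%:R * (h%:R / theta).
      by rewrite mulrA ler_peMl ?invr_ge0 ?(ltW theta0)// mulr_ege1.
    have ti : 0 < theta^-1 by rewrite invr_gt0.
    by rewrite /De ger0_norm; lra.
  move=> hD; apply: (@le_trans _ _ (X%:R * theta^-1)); last by rewrite ler_pM2l.
  rewrite ler_pdivlMr//; apply: le_trans XE; by rewrite ler_pM2l.
have [j ej] : exists j : nat, al = j by case: (al) al0 => // j _; exists j.
rewrite ej in al0 dE; have alR : 0 < j%:R :> R by rewrite ltr0n.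
have hal : j%:R <= 2 * h%:R * q%:R :> R.
  have : j%:R - q%:R * (h%:R / theta) <= 1.
    by apply: le_trans (ltW De1); rewrite /De ej distrC; apply: ler_norm.
  have : q%:R * (h%:R / theta) <= q%:R * h%:R.
    by rewrite ler_pM2l// ler_pdivrMr// ler_peMr// ltW.
  have : 1 <= q%:R * h%:R :> R by rewrite mulr_ege1.
  lra.
have h1 : c * j%:R `^ (- kappa) <= theta * De.
  by rewrite -dE; apply: le_trans (hc j al0) _; exact: dist_int_le.
have h2 : C * X%:R `^ (- (eta * kappa)) <= De.
  have e1 : (2 * h%:R * X%:R `^ eta) `^ (- kappa) <= j%:R `^ (- kappa).
    rewrite !powRN lef_pV2 ?posrE ?powR_gt0 ?mulr_gt0//.
    apply: ge0_ler_powR; rewrite ?nnegrE ?(ltW kappa0) ?mulr_ge0 ?powR_ge0//.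
    by apply: (le_trans hal); rewrite ler_pM2l ?mulr_gt0// ltW.
  rewrite -(ler_pM2l theta0); apply: le_trans h1.
  have -> : theta * (C * X%:R `^ (- (eta * kappa))) = c * (2 * h%:R * X%:R `^ eta) `^ (- kappa).
    rewrite powRM ?mulr_ge0 ?powR_ge0// -powRrM mulrN /C.
    by field; rewrite gt_eqF.
  by rewrite ler_pM2l.
apply: (@le_trans _ _ (X%:R * (C * X%:R `^ (- (eta * kappa))))); last by rewrite ler_pM2l.
have -> : X%:R * (C * X%:R `^ (- (eta * kappa))) = C * (X%:R `^ eta * X%:R `^ eta).
  rewrite mulrCA -[in RHS]powRD ?(gt_eqF XR) ?implybT// -ek.
  by rewrite powRD ?(gt_eqF XR) ?implybT// powRr1// ltW.
rewrite mulrA ler_peMl ?(ltW E0)//.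
by rewrite -ler_pdivrMl// mulr1.
Qed.

(** The two ranges meet at [y ^ k]. In the dense one a bound [d c X] is enough, because the smooth
    integers number at least [c X]. *)
Lemma smooth_weyl (mu : R) : 0 < mu -> mu < 3^-1 -> forall d, 0 < d ->
  exists X0 : nat, forall X y, (X0 <= X)%N -> ln X%:R <= y%:R `^ mu -> forall phi,
  `|\sum_(m <- smooths X y) cos (2 * pi * (m%:R * (h%:R / theta)) + phi)|
    <= d * (size (smooths X y))%:R.
Proof.
move=> mu0 mu3 d d0; have [eta /andP[eta0 eta2] ap] := finite_type_approx.
have [k hk] := sparse_cos_sum mu0 mu3 eta0 eta2 ap.
have [Xs hs] := hk d d0.
have [c c0 [Xc hc]] := @smooths_density R k.
have [Xd hd] := @dense_cos_sum R _ k _ (mulr_gt0 d0 c0) finite_type_irrational.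
exists (maxn Xs (maxn Xc Xd)) => X y; rewrite !geq_max => /and3P[X1 X2 X3] lX phi.
case: (leqP X (y ^ k)) => Xy; last exact: hs.
by apply: (le_trans (hd X y X3 Xy phi)); rewrite -mulrA ler_pM2l// hc.
Qed.

End finite_type.

Lemma smooth_weyl_uniform (theta mu : R) : 1 < theta -> finite_type theta ->
  0 < mu -> mu < 3^-1 -> forall H d, 0 < d ->
  exists X0 : nat, forall X y, (X0 <= X)%N -> ln X%:R <= y%:R `^ mu ->
  forall h phi, (0 < h < H)%N ->
  `|\sum_(m <- smooths X y) cos (2 * pi * (h%:R * - (m%:R / theta)) + phi)|
    <= d * (size (smooths X y))%:R.
Proof.
move=> theta1 ft mu0 mu3 H d d0; elim: H => [|H [X1 hX1]].
  by exists 0%N => X y _ _ h phi; rewrite ltn0 andbF.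
case: (posnP H) => H0; first by exists 0%N => X y _ _ h phi; rewrite H0; case: h.
have [X2 hX2] := smooth_weyl theta1 ft H0 mu0 mu3 d0.
exists (maxn X1 X2) => X y; rewrite geq_max => /andP[XX1 XX2] lX h phi /andP[h0].
rewrite ltnS leq_eqVlt => /orP[/eqP->|hH]; last by apply: hX1 => //; rewrite h0.
rewrite (eq_bigr (fun m => cos (2 * pi * (m%:R * (H%:R / theta)) + - phi))).
  exact: hX2.
by move=> m _; rewrite -cosN; congr cos; ring.
Qed.

Lemma frac_shift (t l : R) : 0 <= l -> l <= frac t -> frac (t - l) < 1 - l.
Proof.
move=> l0 lf; have [i ei] := fracE t; have f1 := frac_lt1 t.
rewrite {1}ei (_ : frac t + i%:~R - l = (frac t - l) + i%:~R); last by ring.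
by rewrite fracDz frac_id; lra.
Qed.

(** Fejer kernels give an upper bound for every arc; the lower bound is the upper bound for the
    complementary arc of length [1 - l]. *)
Lemma smooth_equidistribution (theta mu : R) : 1 < theta -> finite_type theta ->
  0 < mu -> mu < 3^-1 -> forall d, 0 < d ->
  exists X0 : nat, forall X y, (X0 <= X)%N -> ln X%:R <= y%:R `^ mu ->
  forall s l, 0 <= l <= 1 ->
  `|(count (fun m => frac (- (m%:R / theta) - s) < l) (smooths X y))%:R
     - l * (size (smooths X y))%:R| <= d * (size (smooths X y))%:R.
Proof.
move=> theta1 ft mu0 mu3 d' d'0.
pose d := Num.min d' 1.
have d0 : 0 < d by rewrite lt_min d'0 ltr01.
have d1 : d <= 1 by rewrite ge_min lexx orbT.
have dd' : d <= d' by rewrite ge_min lexx.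
(* Each of [2 k], [2 / H] and [8 / (H k ^ 2)] is at most [d / 4], and [H del = d / 20]; with
   [l <= 1] and [d <= 1] the factor in [arc_count_le] stays below [l + d]. *)
pose k := d / 8.
have k0 : 0 < k by rewrite divr_gt0.
have k2 : 0 < d * k ^+ 2 by rewrite mulr_gt0// exprn_gt0.
pose H := (Num.truncn (32 / (d * k ^+ 2))).+1.
have H0 : (0 < H)%N by [].
have HR : 0 < H%:R :> R by rewrite ltr0n.
have hH : 32 / (d * k ^+ 2) <= H%:R by rewrite ltW// truncnS_gt.
have hH2 : 8 / (H%:R * k ^+ 2) <= d / 4.
  rewrite ler_pdivrMr ?mulr_gt0 ?exprn_gt0//.
  by move: hH; rewrite ler_pdivrMr//; lra.
have hH1 : 2 / H%:R <= d / 4.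
  apply: le_trans hH2; rewrite ler_pdivrMr//.
  rewrite (_ : 8 / (H%:R * k ^+ 2) * H%:R = 8 / k ^+ 2); last first.
    by field; rewrite !gt_eqF.
  rewrite ler_pdivlMr ?exprn_gt0//.
  have : k <= 1 by rewrite /k; lra.
  nra.
pose del := d / (20 * H%:R).
have del0 : 0 < del by rewrite divr_gt0 ?mulr_gt0.
have [X0 hX0] := smooth_weyl_uniform theta1 ft mu0 mu3 H del0.
exists X0 => X y XX lX.
have up s l : 0 <= l <= 1 ->
    (count (fun m => frac (- (m%:R / theta) - s) < l) (smooths X y))%:R
     <= (l + d) * (size (smooths X y))%:R.
  move=> /andP[l0 l1].
  have k1 : k <= 1 by rewrite /k; lra.
  have := arc_count_le H0 (ltW del0) (hX0 X y XX lX) s l0 k0 k1.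
  move=> /le_trans; apply; rewrite mulrC ler_wpM2r//.
  have e1 : H%:R * del = d / 20 by rewrite /del; field; rewrite gt_eqF.
  have h2 : 2 * k = d / 4 by rewrite /k; field.
  rewrite e1 h2; move: hH1 hH2; set u := 2 / _; set v := 8 / _ => hu hv.
  have u0 : 0 <= u by rewrite divr_ge0// ltW.
  nra.
move=> s l /andP[l0 l1].
set S := smooths X y in up *; set n : R := (size S)%:R in up *.
have n0 : 0 <= n by [].
have h1 := up s l ltac:(by rewrite l0 l1).
have h2 := up (s + l) (1 - l) ltac:(by apply/andP; split; lra).
have h3 : n <= (count (fun m => (frac (- (m%:R / theta) - s) < l)%R) S)%:R +
     (count (fun m => (frac (- (m%:R / theta) - (s + l)) < 1 - l)%R) S)%:R.
  rewrite -natrD ler_nat -(count_predC (fun m => (frac (- (m%:R / theta) - s) < l)%R)).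
  rewrite leq_add2l; apply: sub_count => m /=; rewrite -leNgt => h.
  by rewrite opprD addrA; exact: frac_shift.
have dn : d * n <= d' * n by rewrite ler_wpM2r.
by rewrite ler_norml; apply/andP; split; lra.
Qed.

End weyl_sums.

(** * Beatty terms as a condition on the phase *)

Section beatty.
Context {R : realType}.

Lemma size_fset_set (A : set nat) (s : seq nat) : finite_set A -> uniq s ->
  (forall m, A m <-> m \in s) -> #|` fset_set A|%fset = size s.
Proof.
move=> fA us h; apply: perm_size; apply: uniq_perm; [exact: fset_uniq|exact: us|].
move=> m; rewrite in_fset_set//; apply/idP/idP => [|/h]; last by rewrite inE.
by rewrite inE => /h.
Qed.

Lemma smoothP (y : R) m : 1 <= y -> (0 < m)%N ->
  smooth y m <-> (lep (Num.truncn y)).-nat m.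
Proof.
move=> y1 m0; have y0 : 0 <= y by lra.
have e : (max_pdiv m <= Num.truncn y)%N = ((max_pdiv m)%:R <= y) by rewrite truncn_ge_nat.
rewrite /smooth /= -e; split => [h|].
  apply/pnatP => // p pp pm; rewrite inE; apply: leq_trans h.
  by apply: max_pdiv_max; rewrite mem_primes pp m0.
move=> /pnatP/(_ _) h; case: (ltnP 1 m) => m1.
  by have := h m0 _ (max_pdiv_prime m1) (max_pdiv_dvd m).
have -> : m = 1%N by lia.
by rewrite truncn_ge_nat.
Qed.

Lemma PsiE (X y : R) : 0 <= X -> 1 <= y ->
  Psi X y = size (smooths (Num.truncn X) (Num.truncn y)).
Proof.
move=> X0 y1; apply: size_fset_set; last 1 first.
- move=> m; rewrite mem_smooths truncn_ge_nat//; split.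
    by move=> [[m0 mX] sm]; rewrite m0 mX; apply/(smoothP y1 m0).
  by move=> /and3P[m0 mX sm]; split => //; apply/(smoothP y1 m0).
- by apply: finite_setIl; exact: finite_initial.
- exact: smooths_uniq.
Qed.

Variables (theta psi : R).
Hypothesis theta1 : 1 < theta.
Hypothesis psi0 : 0 <= psi.

Let theta0 : 0 < theta. Proof. exact: lt_trans theta1. Qed.

(** Written as [- (m / theta) - s] with [s = - (psi / theta)] to fit [smooth_equidistribution]. *)
Let phase (m : nat) : R := - (m%:R / theta) - - (psi / theta).

Let phaseE m : phase m = (psi - m%:R) / theta.
Proof. by rewrite /phase opprK mulrBl addrC. Qed.

(** For [m] the floor of [theta n + psi], adding [n] to the phase gives
    [(theta n + psi - m) / theta], which lies in [[0, 1 / theta)]. *)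
Lemma beatty_phase x m : beatty theta psi x m ->
  [/\ (0 < m)%N, m%:R <= theta * x + psi & frac (phase m) < theta^-1].
Proof.
have t1 := theta1; have t0 := theta0; have p0 := psi0.
move=> [n [n0 nx e]].
have nR : 1 <= n%:R :> R by rewrite ler1n.
have h1 : m%:R <= theta * n%:R + psi by rewrite -[m%:R]/(m%:Z%:~R) e floor_le_tmp.
have h2 : theta * n%:R + psi < m%:R + 1.
  by rewrite -[m%:R]/(m%:Z%:~R) -[1]/(1%:~R) -intrD e floorD1_gt.
have tn : theta <= theta * n%:R by rewrite ler_peMr// ltW.
split.
- by rewrite -(ltr0n R); lra.
- by apply: (le_trans h1); rewrite lerD2r ler_pM2l.
have e2 : phase m = (theta * n%:R + psi - m%:R) / theta + (- n%:Z)%:~R.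
  by rewrite phaseE mulrNz; field; rewrite gt_eqF.
have ti : theta^-1 < 1 by rewrite invf_lt1.
have b1 : 0 <= (theta * n%:R + psi - m%:R) / theta by rewrite divr_ge0 ?(ltW theta0)//; lra.
have b2 : (theta * n%:R + psi - m%:R) / theta < theta^-1.
  by rewrite ltr_pdivrMr// mulVf ?gt_eqF//; lra.
rewrite e2 fracDz frac_id//; apply/andP; split => //; lra.
Qed.

(** The index is recovered as minus the floor of the phase; [m > psi] makes it positive and
    [m + 1 <= theta x] keeps it at most [x]. *)
Lemma phase_beatty x m : psi < m%:R -> m.+1%:R <= theta * x ->
  frac (phase m) < theta^-1 -> beatty theta psi x m.
Proof.
have t1 := theta1; have t0 := theta0; have p0 := psi0.
move=> pm mx hf; have [i ei] := fracE (phase m); have f0 := frac_ge0 (phase m).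
have e1 : theta * (- i)%:~R + psi = m%:R + theta * frac (phase m).
  have -> : frac (phase m) = phase m - i%:~R by rewrite [X in _ = X - _]ei addrK.
  by rewrite phaseE mulrNz; field; rewrite gt_eqF.
have tf1 : theta * frac (phase m) < 1 by rewrite -ltr_pdivlMl// mulr1.
have tf0 : 0 <= theta * frac (phase m) by rewrite mulr_ge0// ltW.
have i0 : 0 < - i.
  rewrite -(ltr0z R) -(ltr_pM2l theta0) mulr0.
  by rewrite -(ltrD2r psi) add0r e1; lra.
have [n en] : exists n : nat, - i = n by case: (- i) i0 => // n _; exists n.
rewrite en in i0 e1; exists n; split => //.
  by rewrite -(ler_pM2l theta0); move: mx; rewrite -natr1 -[n%:R]/(n%:~R); lra.
rewrite -[n%:R]/(n%:~R) e1; apply/esym/floor_def.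
rewrite -[m%:Z%:~R]/(m%:R) intrD -[m%:Z%:~R]/(m%:R); apply/andP; split; lra.
Qed.

Let X x := Num.truncn (theta * x).
Let A (x y : R) := [seq m <- smooths (X x) (Num.truncn y) | frac (phase m) < theta^-1].

(** The exceptions are, on one side, Beatty terms between [theta x] and [theta x + psi], and on the
    other, integers up to [psi] together with the integer part of [theta x]. *)
Lemma smooth_beatty_count_near (x y : R) : 0 <= x -> 1 <= y ->
  `|(smooth_beatty_count theta psi x y)%:R - (size (A x y))%:R| <= psi + 2 :> R.
Proof.
have t1 := theta1; have t0 := theta0; have p0 := psi0.
move=> x0 y1; rewrite /smooth_beatty_count.
set T := beatty theta psi x `&` smooth y.
have fT : finite_set T by apply: finite_setIl; exact: finite_beatty.
have tx0 : 0 <= theta * x by rewrite mulr_ge0// ltW.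
have pt : (Num.truncn psi)%:R <= psi by rewrite truncn_le.
have pt2 := truncnS_gt psi; have Xt := truncnS_gt (theta * x).
have Xle : (X x)%:R <= theta * x by rewrite truncn_le.
rewrite -[(Num.truncn psi).+1%:R]natr1 in pt2; rewrite -natr1 in Xt.
have h1 : (#|` fset_set T|%fset <= size (A x y) + (Num.truncn psi).+1)%N.
  rewrite -[X in (_ <= _ + X)%N](size_iota (X x).+1) -size_cat; apply: uniq_leq_size.
    exact: fset_uniq.
  move=> m; rewrite in_fset_set// inE => -[bm sm].
  have [m0 mx fm] := beatty_phase bm.
  rewrite mem_cat mem_filter fm mem_smooths m0 mem_iota /=.
  case: (leqP m (X x)) => mX; first by rewrite (smoothP y1 m0).1.
  rewrite orbC /=; apply/orP; left.
  rewrite -(ltr_nat R) natrD -natr1 -[(Num.truncn psi).+1%:R]natr1 /X; lra.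
have h2 : (size (A x y) <= #|` fset_set T|%fset + (Num.truncn psi).+2)%N.
  have -> : (Num.truncn psi).+2 = size (X x :: iota 0 (Num.truncn psi).+1) by rewrite /= size_iota.
  rewrite -size_cat; apply: uniq_leq_size; first by rewrite !filter_uniq ?iota_uniq.
  move=> m; rewrite mem_filter mem_smooths => /andP[fm /and3P[m0 mX sm]].
  rewrite mem_cat inE mem_iota /= add0n.
  case: (ltnP m (Num.truncn psi).+1) => mpsi; first by rewrite !orbT.
  case: (eqVneq m (X x)) => mX'; first by rewrite orbT.
  rewrite /= orbF in_fset_set//; apply/mem_set; split; last by apply/(smoothP y1 m0).
  apply: phase_beatty => //; first by apply: lt_le_trans (truncnS_gt psi) _; rewrite ler_nat.
  by apply: le_trans Xle; rewrite ler_nat ltn_neqAle mX'.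
move: h1 h2; rewrite -!(ler_nat R) !natrD -[(Num.truncn psi).+2%:R]natr1 -[(Num.truncn psi).+1%:R]natr1.
by move=> h1 h2; rewrite ler_norml; apply/andP; split; lra.
Qed.

Lemma smooth_beatty_limit (eps : R) : finite_type theta -> 0 < eps ->
  forall e, 0 < e -> exists x0 : R, forall x y, x0 <= x -> ln x `^ (3 + eps) <= y ->
  `|theta * (smooth_beatty_count theta psi x y)%:R / (Psi (theta * x) y)%:R - 1| <= e.
Proof.
have t1 := theta1; have t0 := theta0; have p0 := psi0.
move=> ft eps0 e e0.
(* Any value strictly between [1 / (3 + eps)] and 1/3 would do. *)
pose mu := (3 + eps / 2)^-1.
have mu0 : 0 < mu by rewrite invr_gt0; lra.
have mu3 : mu < 3^-1 by rewrite ltf_pV2 ?posrE; lra.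
pose d := e / (2 * theta).
have d0 : 0 < d by rewrite divr_gt0 ?mulr_gt0.
have [X0 hX0] := smooth_equidistribution theta1 ft mu0 mu3 d0.
(* Since [y ^ mu >= (ln x) ^ (1 + a)], the factor [(ln x) ^ a >= 4] pays for
   [ln (theta x) <= 2 ln x] and for rounding [y] down. *)
pose a := (3 + eps) * mu - 1.
have a0 : 0 < a by rewrite subr_gt0 /mu ltr_pdivlMr; lra.
have [l0 l01 hl0] := @powR_large R a 4 a0.
(* Once the number [P] of smooth integers exceeds [B], the error [psi + 2] is at most [d P]. *)
pose B := (psi + 2) / d.
have B0 : 0 <= B by rewrite divr_ge0 ?(ltW d0)// addr_ge0.
pose l1 := l0 + 2 * B + 3.
exists (theta + X0%:R + 1 + B + expR l1) => x y xx hy.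
have ex0 : 0 < expR l1 by rewrite expR_gt0.
have X00 : 0 <= X0%:R :> R by [].
have x1 : 1 <= x by lra.
have xp : 0 < x by lra.
have ll : l1 <= ln x.
  by rewrite -[leLHS]expRK ler_ln ?posrE//; lra.
set l := ln x in ll hy.
have lp : 0 < l by rewrite /l1 in ll; lra.
have y3 : l <= y.
  apply: le_trans hy; apply: le1r_powR; rewrite /l1 in ll; lra.
have y2 : 2 <= y by rewrite /l1 in ll; lra.
have y1 : 1 <= y by lra.
have yp : 0 < y by lra.
set Xn := Num.truncn (theta * x); set yn := Num.truncn y.
have Xx : Xn%:R <= theta * x by rewrite truncn_le mulr_ge0// ltW.
have xtx : x <= theta * x by rewrite ler_peMl// ltW.
have Xx' : x - 1 <= Xn%:R by have := truncnS_gt (theta * x); rewrite -natr1 -/Xn; lra.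
have yn2 : y / 2 <= yn%:R by have := truncnS_gt y; rewrite -natr1 -/yn; lra.
have Xn0 : 0 < Xn%:R :> R by lra.
have lX : ln Xn%:R <= yn%:R `^ mu.
  have h1 : ln Xn%:R <= 2 * l.
    apply: (@le_trans _ _ (ln (theta * x))); first by rewrite ler_ln ?posrE ?mulr_gt0.
    rewrite lnM ?posrE// -/l; have : ln theta <= l by rewrite /l ler_ln ?posrE//; lra.
    lra.
  have h2 : (y / 2) `^ mu <= yn%:R `^ mu.
    by apply: ge0_ler_powR => //; rewrite ?nnegrE ?(ltW mu0)// divr_ge0// ltW.
  have h3 : y `^ mu <= 2 * (y / 2) `^ mu.
    have {1}-> : y = 2 * (y / 2) by field.
    rewrite powRM// ?divr_ge0 ?(ltW yp)// ler_wpM2r ?powR_ge0//.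
    by apply: ler1_powR; lra.
  have h4 : l `^ a * l <= y `^ mu.
    have -> : l `^ a * l = (l `^ (3 + eps)) `^ mu.
      rewrite -powRrM -{2}[l]powRr1 ?(ltW lp)// -powRD ?(gt_eqF lp) ?implybT//.
      by congr powR; rewrite /a; ring.
    by apply: ge0_ler_powR => //; rewrite ?nnegrE ?powR_ge0 ?(ltW mu0) ?(ltW yp).
  have h5 : 4 <= l `^ a by apply: hl0; rewrite /l1 in ll; lra.
  have h6 : 4 * l <= l `^ a * l by rewrite ler_pM2r.
  lra.
have XX0 : (X0 <= Xn)%N by rewrite -(ler_nat R); lra.
have ti : theta^-1 < 1 by rewrite invf_lt1.
have ti0 : 0 < theta^-1 by rewrite invr_gt0.
have := hX0 Xn yn XX0 lX (- (psi / theta)) theta^-1 ltac:(by apply/andP; split; lra).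
rewrite -size_filter -/(A x y).
have xge0 : 0 <= x by lra.
have := smooth_beatty_count_near xge0 y1.
rewrite PsiE ?mulr_ge0 ?(ltW theta0)// -/Xn -/yn.
set C : R := (smooth_beatty_count theta psi x y)%:R; set a' : R := (size (A x y))%:R.
set P : R := (size (smooths Xn yn))%:R => hC hA.
(* All integers up to the smaller of [Xn] and [yn] are smooth, and there are at least [B + 1] of
   them. *)
have BP : B + 1 <= P.
  have [m0 [hm1 hm2 hm3]] : exists m : nat, [/\ (m <= Xn)%N, (m <= yn)%N & B + 1 <= m%:R].
    exists (minn Xn yn); split; rewrite ?geq_minl ?geq_minr//.
    by case: (leqP Xn yn) => _; rewrite /l1 in ll; lra.
  apply: (le_trans hm3); rewrite ler_nat -(size_iota 1 m0); apply: uniq_leq_size.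
    exact: iota_uniq.
  move=> m; rewrite mem_iota add1n ltnS mem_smooths => /andP[m1 mm].
  rewrite m1 (leq_trans mm hm1)/=; apply/pnatP => // p pp pm.
  by rewrite inE (leq_trans (dvdn_leq m1 pm))// (leq_trans mm).
have P0 : 0 < P by lra.
have Bd : psi + 2 <= d * P.
  by rewrite mulrC -ler_pdivrMr// -/B; lra.
have hCP : `|C - theta^-1 * P| <= 2 * (d * P).
  have -> : C - theta^-1 * P = (C - a') + (a' - theta^-1 * P) by ring.
  by apply: (le_trans (ler_normD _ _)); lra.
have -> : theta * C / P - 1 = theta / P * (C - theta^-1 * P).
  by field; rewrite !gt_eqF.
rewrite normrM gtr0_norm ?divr_gt0//.
apply: (@le_trans _ _ (theta / P * (2 * (d * P)))); first by rewrite ler_pM2l ?divr_gt0.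
by rewrite /d le_eqVlt; apply/orP; left; apply/eqP; field; rewrite !gt_eqF.
Qed.

End beatty.
Theorem theorem1 (R : realType) (theta psi eps : R)
    (htheta1 : 1 < theta) (hirr : irrational theta)
    (hft : finite_type theta) (hpsi : 0 <= psi) (heps : 0 < eps) :
  ereal_sup
    [set (`| theta * (smooth_beatty_count theta psi x y)%:R
             / (Psi (theta * x) y)%:R - 1 |)%:E
    | y in [set y : R | ln x `^ (3 + eps) <= y /\ y <= x]]
    @[x --> +oo%R] --> 0%:E.
Proof.
have theta0 : 0 < theta by apply: lt_trans htheta1.
have a0 : 0 < (3 + eps)^-1 by rewrite invr_gt0; lra.
have [x1 x11 hx1] := ln_le_powR 1 a0.
pose dev (x y : R) : R := `| theta * (smooth_beatty_count theta psi x y)%:R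
  / (Psi (theta * x) y)%:R - 1 |.
pose F (x : R) : \bar R :=
  ereal_sup [set (dev x y)%:E | y in [set y : R | ln x `^ (3 + eps) <= y /\ y <= x]].
change (F x @[x --> +oo%R] --> 0%:E).
have bnd (e : R) : 0 < e -> \forall x \near +oo%R, (0%:E <= F x <= e%:E)%E.
  move=> e0; have [x0 hx0] := smooth_beatty_limit htheta1 hpsi hft heps e0.
  exists (Num.max x0 x1); split; first exact: num_real.
  move=> x; rewrite gt_max => /andP[/ltW xx0 /ltW xx1].
  have xge1 : 1 <= x by apply: le_trans xx1.
  have lx0 : 0 <= ln x by apply: ln_ge0.
  apply/andP; split; last by apply: ge_ereal_sup => _ [y [hy _] <-]; rewrite lee_fin hx0.
  (* The supremum of an empty set would be [-oo]. The point [y = x] lies in the range as soon as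
     [ln x <= x ^ (1 / (3 + eps))], which is what [x1] ensures. *)
  apply: (@le_trans _ _ (dev x x)%:E); first by rewrite lee_fin normr_ge0.
  apply: ereal_sup_ubound; exists x => //; split => //.
  have := hx1 x xx1; rewrite mul1r => h.
  apply: (@le_trans _ _ ((x `^ (3 + eps)^-1) `^ (3 + eps))).
    by apply: ge0_ler_powR; rewrite ?nnegrE ?powR_ge0//; lra.
  by rewrite -powRrM mulVf ?powRr1//; [lra|rewrite gt_eqF//; lra].
have fin x (e : R) : (0%:E <= F x <= e%:E)%E -> F x \is a fin_num.
  by case/andP=> h0 h1; rewrite ge0_fin_numE// (le_lt_trans h1)// ltry.
apply/fine_cvgP; split; first by apply: filterS (bnd 1 ltr01) => x /fin.
apply/cvgrPdist_le => e e0; apply: filterS (bnd e e0) => x hx /=.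
have hf := fin _ _ hx; case/andP: hx => h0 h1.
by rewrite sub0r normrN ger0_norm ?fine_ge0// -lee_fin fineK.
Qed.
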